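(* Let $(R,\mathfrak{m},k)$ be a commutative noetherian local Cohen--Macaulay ring of Krull dimension $d$ with a dualizing module $\Omega$, and let $M$ be a finitely generated $R$-module. For every $n\geqslant d$ the $n^{\mathrm{th}}$ cosyzygy, $\operatorname{Cosyz}_{\mathsf{MCM}}^{n}(M)$, of $M$ with respect to $\mathsf{MCM}$ is maximal CM.
   Context: $R$ is a commutative noetherian local Cohen--Macaulay ring with maximal ideal $\mathfrak{m}$, residue field $k$, Krull dimension $d$, and a dualizing (canonical) module $\Omega$. For a finitely generated $R$-module $M$, $\operatorname{depth}_R M=\inf\{i \mid \operatorname{Ext}^i_R(k,M)\neq 0\}\in\mathbb{N}_0\cup\{\infty\}$. A finitely generated $R$-module $M$ is called maximal Cohen--Macaulay (maximal CM) if $\operatorname{depth}_R M\geqslant d$ (so the zero module is maximal CM). $\mathsf{MCM}$ denotes the full subcategory of maximal CM modules in the category of finitely generated $R$-modules. An $\mathsf{MCM}$-preenvelope of a finitely generated $R$-module $M$ is a homomorphism $\mu\colon M\to X$ with $X\in\mathsf{MCM}$ such that every homomorphism $M\to X'$ with $X'\in\mathsf{MCM}$ factors through $\mu$. Over $R$ every finitely generated module has an $\mathsf{MCM}$-preenvelope. Cosyzygies: set $C^0=M$; recursively, for $i\geqslant 0$, take any $\mathsf{MCM}$-preenvelope $\mu^i\colon C^i\to X^i$ and set $C^{i+1}=\operatorname{Coker}\mu^i$. The module $C^n$ is called the $n^{\mathrm{th}}$ cosyzygy of $M$ with respect to $\mathsf{MCM}$ and is denoted $\operatorname{Cosyz}_{\mathsf{MCM}}^{n}(M)$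 (so $\operatorname{Cosyz}_{\mathsf{MCM}}^{0}(M)=M$). It depends on the choice of preenvelopes, but if $C^n$ and $\bar C^n$ arise from two choices, then $C^n\oplus\bar A\cong\bar C^n\oplus A$ for some $A,\bar A\in\mathsf{MCM}$, so whether it is maximal CM does not depend on the choices; the claim is that it is maximal CM for every choice. *)

(* Defs.v *)
From HB Require Import structures.
From mathcomp Require Import all_boot all_order all_algebra.
From mathcomp Require Import boolp freeg.

Set Implicit Arguments.
Unset Strict Implicit.
Unset Printing Implicit Defensive.

Import GRing.Theory.

Local Open Scope ring_scope.
Local Open Scope quotient_scope.

Section HomModule.
Variables (R : comNzRingType) (U V : lmodType R).

Definition Hom : Type := {linear U -> V}.

HB.instance Definition _ := gen_eqMixin Hom.
HB.instance Definition _ := gen_choiceMixin Hom.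

Lemma hom_ext (f g : Hom) :
  (forall x, (f : {linear U -> V}) x = (g : {linear U -> V}) x) -> f = g.
Proof.
case: f => f [[fa] [fs]]; case: g => g [[ga] [gs]] /= /funext fg.
by subst g; rewrite (Prop_irrelevance fa ga) (Prop_irrelevance fs gs).
Qed.

Definition hom0 : Hom := (\0 : {linear U -> V}).
Definition hom_add (f g : Hom) : Hom :=
  ((f : {linear U -> V}) \+ (g : {linear U -> V})).
Definition hom_scale (a : R) (f : Hom) : Hom := (a \*: (f : {linear U -> V})).
Definition hom_opp (f : Hom) : Hom := (-1) \*: (f : {linear U -> V}).

Lemma hom_addA : associative hom_add.
Proof. by move=> f g h; apply: hom_ext => x /=; rewrite addrA. Qed.
Lemma hom_addC : commutative hom_add.
Proof. by move=> f g; apply: hom_ext => x /=; rewrite addrC. Qed.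
Lemma hom_add0 : left_id hom0 hom_add.
Proof. by move=> f; apply: hom_ext => x /=; rewrite add0r. Qed.
Lemma hom_addN : left_inverse hom0 hom_opp hom_add.
Proof. by move=> f; apply: hom_ext => x /=; rewrite scaleN1r addNr. Qed.

HB.instance Definition _ :=
  GRing.isZmodule.Build Hom hom_addA hom_addC hom_add0 hom_addN.

Lemma hom_scaleA a b (f : Hom) :
  hom_scale a (hom_scale b f) = hom_scale (a * b) f.
Proof. by apply: hom_ext => x /=; rewrite scalerA. Qed.
Lemma hom_scale1 : left_id 1 hom_scale.
Proof. by move=> f; apply: hom_ext => x /=; rewrite scale1r. Qed.
Lemma hom_scaleDr : right_distributive hom_scale +%R.
Proof. by move=> a f g; apply: hom_ext => x /=; rewrite scalerDr. Qed.
Lemma hom_scaleDl (f : Hom) : {morph hom_scale^~ f : a b / a + b}.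
Proof. by move=> a b; apply: hom_ext => x /=; rewrite scalerDl. Qed.

HB.instance Definition _ := GRing.Zmodule_isLmodule.Build R Hom
  hom_scaleA hom_scale1 hom_scaleDr hom_scaleDl.

End HomModule.

Section Submodules.
Variable R : comNzRingType.

Section Quotient.
Variables (V : lmodType R) (S : {pred V}) (closedS : submod_closed S).

Definition submod_pred of submod_closed S : {pred V} := S.
Local Notation SS := (submod_pred closedS).
HB.instance Definition _ := GRing.isSubmodClosed.Build R V SS closedS.

Definition quotm : Type := Quotient.quot SS.
Local Notation Q := quotm.

HB.instance Definition _ := GRing.Zmodule.on Q.

Definition quotm_pi (x : V) : Q := \pi_(Quotient.quot SS) x.

Lemma quotm_pi_surj (y : Q) : exists x, quotm_pi x = y.
Proof. by exists (repr y); rewrite /quotm_pi reprK. Qed.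

Lemma quotm_piE x y : (quotm_pi x = quotm_pi y) <-> (x - y \in S).
Proof.
rewrite (Quotient.idealrBE SS).
by split=> [h | /eqP //]; apply/eqP.
Qed.

Lemma quotm_piB : {morph quotm_pi : x y / x - y}.
Proof. exact: (@raddfB _ _ (\pi_(Quotient.quot SS))). Qed.
Lemma quotm_piD : {morph quotm_pi : x y / x + y}.
Proof. exact: (@raddfD _ _ (\pi_(Quotient.quot SS))). Qed.

Definition quotm_scale (a : R) (y : Q) : Q :=
  quotm_pi (a *: repr (y : Quotient.quot SS)).

Lemma quotm_piZ a x : quotm_pi (a *: x) = quotm_scale a (quotm_pi x).
Proof.
apply/quotm_piE; rewrite -scalerBr; apply: (@rpredZ _ _ SS).
by apply/quotm_piE; rewrite /quotm_pi reprK.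
Qed.

Lemma quotm_scaleA a b y :
  quotm_scale a (quotm_scale b y) = quotm_scale (a * b) y.
Proof.
by have [x <-] := quotm_pi_surj y; rewrite -!quotm_piZ scalerA.
Qed.
Lemma quotm_scale1 : left_id 1 quotm_scale.
Proof.
by move=> y; have [x <-] := quotm_pi_surj y; rewrite -quotm_piZ scale1r.
Qed.
Lemma quotm_scaleDr : right_distributive quotm_scale +%R.
Proof.
move=> a y z; have [u <-] := quotm_pi_surj y; have [v <-] := quotm_pi_surj z.
by rewrite -quotm_piD -!quotm_piZ scalerDr quotm_piD.
Qed.
Lemma quotm_scaleDl y : {morph quotm_scale^~ y : a b / a + b}.
Proof.
move=> a b; have [u <-] := quotm_pi_surj y.
by rewrite -!quotm_piZ scalerDl quotm_piD.
Qed.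

HB.instance Definition _ := GRing.Zmodule_isLmodule.Build R Q
  quotm_scaleA quotm_scale1 quotm_scaleDr quotm_scaleDl.

Lemma quotm_pi_linear : linear quotm_pi.
Proof. by move=> a x y; rewrite quotm_piD quotm_piZ. Qed.
HB.instance Definition _ := GRing.isLinear.Build R V Q _ quotm_pi
  quotm_pi_linear.

End Quotient.

Section KernelCokernel.
Variables (U V : lmodType R) (f : {linear U -> V}).

Definition in_ker : pred U := fun x => f x == 0.
Definition in_im : pred V := fun y => `[< exists x, y = f x >].

Lemma in_ker_closed : submod_closed in_ker.
Proof.
split=> [|a x y]; rewrite /in_mem /= /in_ker ?linear0 // => /eqP fx /eqP fy.
by rewrite linearP fx fy scaler0 addr0.
Qed.
HB.instance Definition _ := GRing.isSubmodClosed.Build R U in_ker in_ker_closed.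

Lemma in_im_closed : submod_closed in_im.
Proof.
split=> [|a _ _ /asboolP[x ->] /asboolP[y ->]]; apply/asboolP.
  by exists 0; rewrite linear0.
by exists (a *: x + y); rewrite linearP.
Qed.

Definition ker : Type := {x | in_ker x}.
HB.instance Definition _ := SubChoice.on ker.
HB.instance Definition _ := [SubChoice_isSubLmodule of ker by <:].

Definition coker : lmodType R := quotm in_im_closed.

End KernelCokernel.
End Submodules.

Section FreeResolution.
Variable R : comNzRingType.

Section FreeCover.
Variable V : lmodType R.

Definition free_on : lmodType R := {freeg V / R}.

Definition aug (D : free_on) : V := fglift (fun x : V => x) D.

Lemma aug_linear : linear aug.
Proof.
have augB : {morph aug : x y / x - y} by exact: lift_is_additive.
have aug0 : aug 0 = 0 by rewrite -[in LHS](subrr 0) augB subrr.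
have augD : {morph aug : x y / x + y}.
  by move=> x y; rewrite -[y]opprK augB -[- y]sub0r !augB aug0 !sub0r !opprK.
have aug_sum (s : seq V) (F : V -> free_on) :
    aug (\sum_(x <- s) F x) = \sum_(x <- s) aug (F x).
  by elim: s => [|x s ih]; rewrite ?big_nil // !big_cons augD ih.
have augU c x : aug << c *g x >> = c *: x by exact: liftU.
move=> a x y; rewrite augD; congr (_ + _).
rewrite {1}/GRing.scale /= /fgscale -[x in RHS]freeg_sumE !aug_sum scaler_sumr.
by apply: eq_bigr => z _; rewrite !augU scalerA.
Qed.

HB.instance Definition _ := GRing.isLinear.Build R free_on V _ aug aug_linear.

Lemma aug_surj (x : V) : exists D, aug D = x.
Proof. by exists << x >>; rewrite /aug liftU scale1r. Qed.

End FreeCover.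

(* The canonical free resolution of N: the syzygies are K_0 = N and
   K_{n+1} = ker (R^(K_n) -> K_n), and the resolution has R^(K_n) in degree n,
   where R^(V) is the free module on the set of elements of V. *)
Fixpoint syzygy (N : lmodType R) (n : nat) : lmodType R :=
  if n is n'.+1 then ker (@aug (syzygy N n')) else N.

Definition res (N : lmodType R) (n : nat) : lmodType R := free_on (syzygy N n).

Definition res_diff (N : lmodType R) (n : nat) : res N n.+1 -> res N n :=
  fun D => val (aug D : ker (@aug (syzygy N n))).

Lemma res_diff_linear N n : linear (@res_diff N n).
Proof. by move=> a x y; rewrite /res_diff !linearP. Qed.

HB.instance Definition _ N n :=
  GRing.isLinear.Build R (res N n.+1) (res N n) _ (@res_diff N n)
    (@res_diff_linear N n).

Lemma res_exact0 N (x : res N 0) :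
  aug x = 0 <-> exists y, x = res_diff y.
Proof.
split=> [x0|[y ->]]; last by apply/eqP; apply: (valP (aug y)).
have xk : in_ker (@aug (syzygy N 0)) x by apply/eqP.
have [y yE] := aug_surj (exist _ x xk : ker (@aug (syzygy N 0))).
by exists y; rewrite /res_diff yE.
Qed.

Lemma res_exactS N n (x : res N n.+1) :
  res_diff x = 0 <-> exists y, x = res_diff y.
Proof.
have -> : res_diff x = 0 <-> aug x = 0.
  by split=> [h|h]; [apply: val_inj | rewrite /res_diff h].
split=> [x0|[y ->]]; last by apply/eqP; apply: (valP (aug y)).
have xk : in_ker (@aug (syzygy N n.+1)) x by apply/eqP.
have [y yE] := aug_surj (exist _ x xk : ker (@aug (syzygy N n.+1))).
by exists y; rewrite /res_diff yE.
Qed.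

End FreeResolution.

Section Ext.
Variables (R : comNzRingType) (N M : lmodType R).

(* The cochain complex Hom(res N, M). *)
Definition cochain (i : nat) : lmodType R := Hom (res N i) M.

Definition codiff (i : nat) (f : cochain i) : cochain i.+1 :=
  ((f : {linear res N i -> M}) \o @res_diff R N i : {linear _ -> _}).

Lemma codiff_linear i : linear (@codiff i).
Proof. by move=> a f g; apply: hom_ext. Qed.

HB.instance Definition _ i :=
  GRing.isLinear.Build R (cochain i) (cochain i.+1) _ (@codiff i)
    (@codiff_linear i).

Definition cocycle (i : nat) : lmodType R := ker (@codiff i).

Definition coboundary (i : nat) : {pred cocycle i} :=
  match i return pred (cocycle i) with
  | 0 => fun z => z == 0
  | j.+1 => fun z => in_im (@codiff j) (val z)
  end.

Lemma coboundary_closed i : submod_closed (@coboundary i).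
Proof.
case: i => [|i]; split=> [|a x y].
- by rewrite /in_mem /=.
- by rewrite /in_mem /= => /eqP-> /eqP->; rewrite scaler0 addr0.
- exact: (in_im_closed (@codiff i)).1.
- exact: (in_im_closed (@codiff i)).2.
Qed.

Definition Ext (i : nat) : lmodType R := quotm (@coboundary_closed i).

End Ext.

Section Rings.
Variable R : comNzRingType.

Definition fin_gen (M : lmodType R) : Prop :=
  exists (n : nat) (v : 'I_n -> M),
    forall x, exists c : 'I_n -> R, x = \sum_(i < n) c i *: v i.

(* Ideals are the submodules of R^o; idealr_closed, by contrast, describes
   the proper ideals only. *)
Definition noetherian : Prop :=
  forall I : {pred R^o}, submod_closed I ->
    exists (n : nat) (v : 'I_n -> R), (forall i, v i \in I) /\
      forall x, x \in I -> exists c : 'I_n -> R, x = \sum_(i < n) c i * v i.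

Definition maximal_ideal (I : {pred R}) : Prop :=
  idealr_closed I /\
  forall J : {pred R}, idealr_closed J -> {subset I <= J} -> J =i I.

Definition local_ring (m : idealr R) : Prop :=
  maximal_ideal m /\ forall I : {pred R}, maximal_ideal I -> I =i m.

Definition prime_ideal (I : {pred R}) : Prop :=
  idealr_closed I /\ prime_idealr_closed I.

(* p 0 < p 1 < ... < p n is a chain of n strict inclusions. *)
Definition prime_chain (n : nat) (p : nat -> {pred R}) : Prop :=
  (forall i, (i <= n)%N -> prime_ideal (p i)) /\
  (forall i, (i < n)%N ->
     {subset p i <= p i.+1} /\ exists2 x, x \in p i.+1 & x \notin p i).

Definition krull_dim (d : nat) : Prop :=
  (exists p, prime_chain d p) /\
  (forall n p, prime_chain n p -> (n <= d)%N).

Lemma idealr_submod (m : idealr R) : submod_closed (m : {pred R^o}).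
Proof.
split=> [|a x y xm ym]; first exact: (rpred0 m).
by apply: (@rpredD _ m) => //; apply: idealMr.
Qed.

Definition residue_field (m : idealr R) : lmodType R :=
  quotm (idealr_submod m).

End Rings.

Arguments noetherian R : clear implicits.
Arguments krull_dim R d : clear implicits.

Section MaximalCohenMacaulay.
Variables (R : comNzRingType) (m : idealr R).
Local Notation k := (residue_field m).

Definition Ext_neq0 (N M : lmodType R) (i : nat) : bool :=
  `[< exists x : Ext N M i, x != 0 >].

(* None stands for infinite depth. *)
Definition depth (M : lmodType R) : option nat :=
  if pselect (exists i, Ext_neq0 k M i) is left ex
  then Some (ex_minn ex) else None.

Definition depth_ge (M : lmodType R) (d : nat) : bool :=
  if depth M is Some n then (d <= n)%N else true.

Definition cohen_macaulay : Prop :=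
  exists d, krull_dim R d /\ depth R^o = Some d.

(* In mcm, dualizing, mcm_preenvelope and cosyzygy, the parameter d is meant
   to be the Krull dimension of R. *)
Definition mcm (d : nat) (M : lmodType R) : Prop := fin_gen M /\ depth_ge M d.

Definition injective_module (E : lmodType R) : Prop :=
  forall (A B : lmodType R) (i : {linear A -> B}) (f : {linear A -> E}),
    injective i -> exists g : {linear B -> E}, forall x, g (i x) = f x.

Definition finite_injdim (M : lmodType R) : Prop :=
  exists (n : nat) (E : nat -> lmodType R) (eta : {linear M -> E 0%N})
         (del : forall i, {linear E i -> E i.+1}),
  [/\ forall i, injective_module (E i),
      forall i, (n < i)%N -> forall x : E i, x = 0,
      injective eta,
      forall x, del 0%N x = 0 <-> exists y, x = eta y
    & forall i x, del i.+1 x = 0 <-> exists y, x = del i y].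

Definition isomorphic (U V : lmodType R) : Prop :=
  exists f : {linear U -> V}, bijective f.

(* Maximal CM of type 1 and of finite injective dimension. The type of a module
   of depth d is the dimension over k of Ext^d(k, -), which m annihilates; it is
   1 exactly when that module is isomorphic to k over R. *)
Definition dualizing (d : nat) (Omega : lmodType R) : Prop :=
  [/\ mcm d Omega, finite_injdim Omega & isomorphic (Ext k Omega d) k].

Definition mcm_preenvelope (d : nat) (M X : lmodType R) (mu : {linear M -> X})
    : Prop :=
  mcm d X /\
  forall (X' : lmodType R) (g : {linear M -> X'}), mcm d X' ->
    exists h : {linear X -> X'}, forall x, g x = h (mu x).

(* cosyzygy d M n C: C is an n-th cosyzygy of M for some choice of
   preenvelopes. *)
Inductive cosyzygy (d : nat) (M : lmodType R) : nat -> lmodType R -> Prop :=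
| cosyzygy0 : cosyzygy d M 0 M
| cosyzygyS (n : nat) (C X : lmodType R) (mu : {linear C -> X}) :
    cosyzygy d M n C -> mcm_preenvelope d mu -> cosyzygy d M n.+1 (coker mu).

End MaximalCohenMacaulay.

(* Main.v *)
Require Import Defs.
From mathcomp Require Import all_boot all_order all_algebra.
From mathcomp Require Import boolp freeg.
From HB Require Import structures.

(** Write X* for Hom(X, Omega), MCM for modules of depth at least d, and recall
    that R itself is MCM.  The idea is to read the construction of cosyzygies
    through the functor X |-> X*.  For a preenvelope mu : C -> X the sequence
    0 -> (coker mu)* -> X* -> C* -> 0 is exact, because Omega is MCM
    ([preenvelope_dual_ses]); X* is MCM, so by the depth lemma the dual of a
    cosyzygy gains one unit of depth at each step, starting from
    depth M* >= min(2, d) ([depth_dual_min2], [cosyzygy_dual_depth]).  Hence the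
    dual of the (d-2)-nd cosyzygy is MCM.  Then the next one, D, has MCM dual and
    the biduality map D -> D** is onto ([mcm_coker_coker]).  Any surjection of D
    onto an MCM module through which a preenvelope D -> X' factors makes its
    target a direct summand of X', with complement the cokernel
    ([mcm_coker]), so the d-th cosyzygy and all the later ones are MCM.  When
    d <= 1, the image of the preenvelope, having positive depth, plays the part
    of D**.

    This rests on the duality of MCM modules: for X MCM, Ext^i(X, Omega) = 0 for
    i > 0, X* is MCM and X = X**.  Let E be a finite injective resolution of
    Omega and H^i(N) the cohomology of Hom(N, E), which is finitely generated
    when N is.

    - H^i(N) = 0 for i > d - depth N ([H_vanishes_depth]).  For depth 0, descend
      on i: k embeds in a quotient T of R by a maximal regular sequence, H^i(T)
      vanishes for i > d, so H^i(k) = 0, and noetherian induction on annihilators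
      extends this to all N.  For positive depth, divide by a regular element,
      obtained by prime avoidance ([regular_exists]), and apply Nakayama.

    - X* is MCM and X = X** by dualizing free covers ([depth_dual],
      [bidual_surj], [bidual_inj]), provided that R = End(Omega).

    - R -> End(Omega) is onto ([End_homothety]): for N of depth t with
      Ext^t(k, N) cyclic, H^(d-t)(N) is cyclic ([H_cyclic_depth]).  This is the
      equality of the type of N and of the number of generators of its dual,
      when they are 1; the case N = Omega says that End(Omega) is cyclic.

    - It is injective ([Om_faithful]): its kernel I is MCM with I* = 0, so that
      every Ext^i(I, Omega) vanishes, and this forces I = 0
      ([Ext_detects_zero]). *)


Set Implicit Arguments.
Unset Strict Implicit.
Unset Printing Implicit Defensive.

Import GRing.Theory.

Local Open Scope ring_scope.
Local Notation Hom := Defs.Hom.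

(** * Linear maps and short exact sequences *)

Section Toolkit.
Variable R : comNzRingType.
Implicit Types A B C U V W : lmodType R.

Definition linear_of U V (f : U -> V) (f_lin : linear f) : {linear U -> V} :=
  HB.pack f (GRing.isLinear.Build R U V _ f f_lin).

Definition surjective U V (f : U -> V) := forall y, exists x, f x = y.

Definition submod V (S : V -> Prop) :=
  S 0 /\ forall a x y, S x -> S y -> S (a *: x + y).

Lemma submodD V (S : V -> Prop) x y : submod S -> S x -> S y -> S (x + y).
Proof. by move=> [_ SD] Sx Sy; rewrite -[x]scale1r; apply: SD. Qed.

Lemma submodZ V (S : V -> Prop) a x : submod S -> S x -> S (a *: x).
Proof. by move=> [S0 SD] Sx; rewrite -[_ *: _]addr0; apply: SD. Qed.

Lemma submod_multiples V (v : V) : submod (fun w => exists a, w = a *: v).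
Proof.
split=> [|c _ _ [a ->] [b ->]]; first by exists 0; rewrite scale0r.
by exists (c * a + b); rewrite scalerDl scalerA.
Qed.

Lemma submod_common_kernel V (s : seq R) :
  submod (fun v : V => forall a, a \in s -> a *: v = 0).
Proof.
split=> [a _|c u v us vs a as_]; first by rewrite scaler0.
by rewrite scalerDr scalerA mulrC -scalerA us // vs // scaler0 addr0.
Qed.

Lemma submodN V (S : V -> Prop) x : submod S -> S x -> S (- x).
Proof. by move=> S_ Sx; rewrite -scaleN1r; apply: submodZ. Qed.

Lemma submodB V (S : V -> Prop) x y : submod S -> S x -> S y -> S (x - y).
Proof. by move=> S_ Sx Sy; apply: submodD => //; apply: submodN. Qed.

Lemma linear_inj U V (f : {linear U -> V}) :
  (forall x, f x = 0 -> x = 0) -> injective f.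
Proof.
by move=> f0 x y fxy; apply/subr0_eq/f0; rewrite linearB fxy subrr.
Qed.

Lemma inj_eq0 U V (f : {linear U -> V}) x : injective f -> f x = 0 -> x = 0.
Proof. by move=> f_inj fx; apply: f_inj; rewrite fx linear0. Qed.

Lemma submod_closedP V (S : V -> Prop) :
  submod S -> submod_closed ((fun x => `[< S x >]) : {pred V}).
Proof.
move=> [S0 SD]; split=> [|a x y]; first exact/asboolP.
by move=> /asboolP Sx /asboolP Sy; apply/asboolP; apply: SD.
Qed.

Definition exact A B C (f : {linear A -> B}) (g : {linear B -> C}) :=
  forall y, g y = 0 <-> exists x, y = f x.

Definition ses A B C (f : {linear A -> B}) (g : {linear B -> C}) :=
  [/\ injective f, surjective g & exact f g].

Lemma ses_comp0 A B C (f : {linear A -> B}) (g : {linear B -> C}) x :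
  ses f g -> g (f x) = 0.
Proof. by move=> [_ _ fg]; apply/fg; exists x. Qed.

Lemma ses_of_surj B C (g : {linear B -> C}) :
  surjective g -> exists A (f : {linear A -> B}), ses f g.
Proof.
move=> g_surj; exists (ker g), (val : {linear ker g -> B}).
split=> // [x y /val_inj // | y]; split=> [gy | [x ->]].
  have yk : in_ker g y by apply/eqP.
  by exists (exist _ y yk).
exact/eqP/(valP x).
Qed.

Lemma ker_exists B C (g : {linear B -> C}) :
  exists A (f : {linear A -> B}), injective f /\ exact f g.
Proof.
exists (ker g), (val : {linear ker g -> B}).
split=> [x y /val_inj // | y]; split=> [gy | [x ->]].
  have yk : in_ker g y by apply/eqP.
  by exists (exist _ y yk).
exact/eqP/(valP x).
Qed.

Definition coker_pi U V (f : {linear U -> V}) : {linear V -> coker f} :=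
  quotm_pi (in_im_closed f).

Lemma coker_pi_surj U V (f : {linear U -> V}) : surjective (coker_pi f).
Proof. exact: quotm_pi_surj. Qed.

Lemma coker_pi_exact U V (f : {linear U -> V}) : exact f (coker_pi f).
Proof.
move=> y; rewrite -[X in _ = X](linear0 (coker_pi f)).
split=> [/quotm_piE | [x ->]]; rewrite ?subr0.
  by move=> /asboolP.
by apply/quotm_piE; rewrite subr0; apply/asboolP; exists x.
Qed.

Lemma ses_coker U V (f : {linear U -> V}) : injective f -> ses f (coker_pi f).
Proof.
by move=> f_inj; split=> //; [apply: coker_pi_surj | apply: coker_pi_exact].
Qed.

Lemma submod_exists V (S : V -> Prop) : submod S ->
  exists U (i : {linear U -> V}),
    injective i /\ forall v, S v <-> exists u, v = i u.
Proof.
move=> /submod_closedP Scl.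
have [U [i [i_inj iP]]] := ker_exists (quotm_pi Scl).
exists U, i; split=> // v; split=> [Sv | /iP].
  apply/iP; rewrite -[RHS](linear0 (quotm_pi Scl)).
  by apply/quotm_piE; rewrite subr0; apply/asboolP.
rewrite -[RHS](linear0 (quotm_pi Scl)) => /quotm_piE.
by rewrite subr0 => /asboolP.
Qed.

Lemma factor_surj B C W (p : {linear B -> C}) (f : {linear B -> W}) :
  surjective p -> (forall x, p x = 0 -> f x = 0) ->
  exists g : {linear C -> W}, forall x, g (p x) = f x.
Proof.
move=> /choice[s sK] pf.
have fs x : f (s (p x)) = f x.
  by apply/subr0_eq; rewrite -linearB pf // linearB sK subrr.
have g_lin : linear (f \o s).
  move=> a y z /=; rewrite -linearP -[in RHS]fs; congr (f (s _)).
  by rewrite linearP !sK.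
by exists (linear_of g_lin) => x; exact: fs.
Qed.

Lemma factor_inj A B W (i : {linear A -> B}) (f : {linear W -> B}) :
  injective i -> (forall x, exists y, f x = i y) ->
  exists g : {linear W -> A}, forall x, i (g x) = f x.
Proof.
move=> i_inj /choice[g gE].
have g_lin : linear g by move=> a x y; apply: i_inj; rewrite linearP -!gE linearP.
by exists (linear_of g_lin) => x; rewrite gE.
Qed.

Lemma image_factor U V (f : {linear U -> V}) :
  exists W (p : {linear U -> W}) (i : {linear W -> V}),
    [/\ surjective p, injective i & forall x, f x = i (p x)].
Proof.
have [K [k [k_inj kf]]] := ker_exists f.
exists (coker k), (coker_pi k).
have pf x : coker_pi k x = 0 -> f x = 0.
  by move=> /coker_pi_exact[y ->]; apply/kf; exists y.
have [i iE] := factor_surj (coker_pi_surj (f := k)) pf.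
exists i; split=> //; first exact: coker_pi_surj.
apply: linear_inj => y; have [x <-] := coker_pi_surj y.
by rewrite iE => /kf fx; apply/coker_pi_exact.
Qed.

Definition homothety V (a : R) : {linear V -> V} := a \*: idfun.

Definition projective P := forall B C (p : {linear B -> C}) (f : {linear P -> C}),
  surjective p -> exists g : {linear P -> B}, forall x, p (g x) = f x.

Lemma fglift_linear V W (h : V -> W) : linear (fglift h : free_on V -> W).
Proof.
have liftB : {morph fglift h : x y / x - y} by exact: lift_is_additive.
have [L LE] : exists L : {additive {freeg V / R} -> W}, L =1 fglift h.
  pose L : {additive {freeg V / R} -> W} :=
    HB.pack (fglift h) (GRing.isZmodMorphism.Build _ _ _ liftB).
  by exists L.
move=> a x y; rewrite -!LE raddfD; congr (_ + _).
rewrite -[x in RHS]freeg_sumE [in RHS]raddf_sum scaler_sumr.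
rewrite {1}/GRing.scale /= /fgscale raddf_sum; apply: eq_bigr => z _.
by rewrite !LE !liftU scalerA.
Qed.

Lemma free_on_hom_ext V W (f g : {linear free_on V -> W}) :
  (forall x, f << x >> = g << x >>) -> forall D, f D = g D.
Proof.
move=> fg D.
have -> : D = \sum_(z <- dom D) coeff z D *: (<< z >> : free_on V).
  rewrite -[LHS]freeg_sumE; apply: eq_bigr => z _.
  by apply/eqP/freeg_eqP => x; rewrite coeffZ !coeffU mul1r.
by rewrite !linear_sum; apply: eq_bigr => z _; rewrite !linearZ fg.
Qed.

Lemma projective_free_on V : projective (free_on V).
Proof.
move=> B C p f p_surj.
have [h hE] := choice (fun x : V => p_surj (f << x >>)).
exists (linear_of (fglift_linear h)) => D.
apply: (free_on_hom_ext (f := p \o linear_of (fglift_linear h))) => x.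
by rewrite /= liftU scale1r hE.
Qed.

Definition row_comb V n (v : 'I_n -> V) (c : 'rV[R]_n) := \sum_i c 0 i *: v i.

Lemma row_comb_linear V n (v : 'I_n -> V) : linear (row_comb v).
Proof.
move=> a x y; rewrite /row_comb scaler_sumr -big_split; apply: eq_bigr => i _.
by rewrite !mxE scalerDl scalerA.
Qed.

Lemma row_comb_delta V n (v : 'I_n -> V) i : row_comb v (delta_mx 0 i) = v i.
Proof.
rewrite /row_comb (bigD1 i) //= big1 ?addr0 ?mxE ?eqxx ?scale1r // => j ji.
by rewrite mxE (negPf ji) andbF scale0r.
Qed.

Lemma row_hom_ext n W (f g : {linear 'rV[R]_n -> W}) :
  (forall i, f (delta_mx 0 i) = g (delta_mx 0 i)) -> forall x, f x = g x.
Proof.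
move=> fg x; rewrite (row_sum_delta x) !linear_sum; apply: eq_bigr => i _.
by rewrite !linearZ fg.
Qed.

Lemma projective_row n : projective 'rV[R]_n.
Proof.
move=> B C p f p_surj.
have [h hE] := choice (fun i : 'I_n => p_surj (f (delta_mx 0 i))).
exists (linear_of (row_comb_linear h)).
apply: (row_hom_ext (f := p \o linear_of (row_comb_linear h))) => i.
by rewrite /= row_comb_delta hE.
Qed.

Lemma fin_gen_cover M : fin_gen M <->
  exists n (p : {linear 'rV[R]_n -> M}), surjective p.
Proof.
split=> [[n [v vP]] | [n [p p_surj]]].
  exists n, (linear_of (row_comb_linear v)) => x.
  have [c ->] := vP x; exists (\row_i c i).
  by rewrite /= /row_comb; apply: eq_bigr => i _; rewrite mxE.
exists n, (fun i => p (delta_mx 0 i)) => y; have [x <-] := p_surj y.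
exists (x 0); rewrite [in LHS](row_sum_delta x) linear_sum.
by apply: eq_bigr => i _; rewrite linearZ.
Qed.

Lemma fin_gen_row n : fin_gen 'rV[R]_n.
Proof. by apply/fin_gen_cover; exists n, idfun => x; exists x. Qed.

Lemma fin_gen_surj A B (p : {linear A -> B}) :
  surjective p -> fin_gen A -> fin_gen B.
Proof.
move=> p_surj /fin_gen_cover[n [q q_surj]]; apply/fin_gen_cover.
exists n, (p \o q) => y; have [x <-] := p_surj y.
by have [z <-] := q_surj x; exists z.
Qed.

End Toolkit.

(** * Noetherian modules *)

Section Span.
Variable R : comNzRingType.
Implicit Types U V W : lmodType R.

(** With coefficients confined to I, one recursion describes both the span of s
    and, for I = m, the submodule m s. *)
Fixpoint span_in (I : R -> Prop) V (s : seq V) (x : V) : Prop :=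
  if s is v :: s' then exists a y, [/\ I a, span_in I s' y & x = a *: v + y]
  else x = 0.

Definition span V := @span_in (fun=> True) V.

Lemma span_in_submod (I : R -> Prop) V (s : seq V) :
  I 0 -> (forall c a b, I a -> I b -> I (c * a + b)) -> submod (span_in I s).
Proof.
move=> I0 ID; split=> [|c x y]; first elim: s => //= v s ih.
  by exists 0, 0; rewrite scale0r addr0.
elim: s x y => [_ _ -> ->|v s ih _ _ [a [x [Ia sx ->]]] [b [y [Ib sy ->]]]] /=.
  by rewrite scaler0 addr0.
exists (c * a + b), (c *: x + y); split; [exact: ID | exact: ih |].
by rewrite scalerDr scalerDl scalerA addrACA.
Qed.

Lemma span_submod V (s : seq V) : submod (span s).
Proof. exact: span_in_submod. Qed.

Lemma span_in_cons (I : R -> Prop) V v (s : seq V) x :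
  I 0 -> span_in I s x -> span_in I (v :: s) x.
Proof. by move=> I0 sx; exists 0, x; rewrite scale0r add0r. Qed.

Lemma span_mem V (s : seq V) v : v \in s -> span s v.
Proof.
elim: s => // u s ih; rewrite inE => /predU1P[-> | /ih]; last first.
  exact: span_in_cons.
by exists 1, 0; split; rewrite ?scale1r ?addr0 //; case: (span_submod s).
Qed.

Lemma span_in_sub (I : R -> Prop) V (S : V -> Prop) (s : seq V) x :
  submod S -> (forall a v, I a -> v \in s -> S (a *: v)) -> span_in I s x -> S x.
Proof.
move=> S_; elim: s x => [_ _ ->|v s ih x sS [a [y [Ia sy ->]]]]; first by case: S_.
apply: submodD => //; first by apply: sS; rewrite ?mem_head.
by apply: ih => // b u Ib us; apply: sS; rewrite // inE us orbT.
Qed.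

Lemma span_sub V (S : V -> Prop) (s : seq V) x :
  submod S -> (forall v, v \in s -> S v) -> span s x -> S x.
Proof. by move=> S_ sS; apply: span_in_sub => // a v _ /sS; apply: submodZ. Qed.

Lemma span_mono V (s t : seq V) x : {subset s <= t} -> span s x -> span t x.
Proof.
by move=> st; apply: span_sub => [|v /st]; [apply: span_submod | apply: span_mem].
Qed.

(** A linear relation lifts to spans; T is typically the graph of a map, or of a
    correspondence given by a connecting homomorphism. *)
Lemma span_relation U V (T : V -> U -> Prop) (t : seq V) (S : U -> Prop) :
  T 0 0 -> (forall a v v' u u', T v u -> T v' u' -> T (a *: v + v') (a *: u + u')) ->
  (forall v, v \in t -> exists2 u, S u & T v u) ->
  exists s : seq U, (forall u, u \in s -> S u) /\
    forall y, span t y -> exists2 x, span s x & T y x.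
Proof.
move=> T0 TD; elim: t => [_|v t ih tS].
  by exists [::]; split=> // y ->; exists 0.
have [u Su Tvu] := tS v (mem_head _ _).
have [w wt|s [sS sP]] := ih; first by apply: tS; rewrite inE wt orbT.
exists (u :: s); split=> [w|y [a [z [_ /sP[x sx Tzx] ->]]]].
  by rewrite inE => /predU1P[-> // | /sS].
by exists (a *: u + x); [exists a, x | apply: TD].
Qed.

Lemma span_map U V (f : {linear U -> V}) (s : seq U) x :
  span s x -> span [seq f v | v <- s] (f x).
Proof.
have [t0 tD] := span_submod [seq f v | v <- s].
apply: (span_sub (S := fun x => span [seq f v | v <- s] (f x))).
  by split=> [|a u v]; rewrite ?linear0 ?linearP //; apply: tD.
by move=> v vs; apply: span_mem; apply: map_f.
Qed.

Definition fin_gen_sub V (S : V -> Prop) :=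
  exists s : seq V, (forall v, v \in s -> S v) /\ forall x, S x -> span s x.

Definition noetherian_module V :=
  forall S : V -> Prop, submod S -> fin_gen_sub S.

Lemma fin_gen_span V : fin_gen V <-> fin_gen_sub (fun _ : V => True).
Proof.
split=> [[n [v vP]] | [s [_ sP]]].
  exists [seq v i | i <- enum 'I_n]; split=> // x _.
  have [c ->] := vP x.
  elim/big_ind: _ => [|y z sy sz|i _].
  - by case: (span_submod [seq v i | i <- enum 'I_n]).
  - by apply: submodD => //; apply: span_submod.
  - apply: submodZ; first exact: span_submod.
    by apply: span_mem; apply: map_f; rewrite mem_enum.
exists (size s), (fun i => s`_i) => x.
move: (sP x I); elim: s x {sP} => [|v s ih] x /=.
  by move=> ->; exists (fun=> 0); rewrite big_ord0.
move=> [a [y [_ /ih[c ->] ->]]].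
exists (fun i => if unlift ord0 i is Some j then c j else a).
rewrite big_ord_recl /= unlift_none; congr (_ + _).
by apply: eq_bigr => i _; rewrite liftK.
Qed.

Fixpoint killed U W (fs : seq {linear U -> W}) (u : U) : Prop :=
  if fs is f :: fs' then f u = 0 /\ killed fs' u else True.

(** A submodule embeds through its joint coordinates in a power of a noetherian
    module, so it is finitely generated: one coordinate at a time, lift
    generators of the image and add generators of the kernel. *)
Lemma fin_gen_joint_embedding U W (fs : seq {linear U -> W}) (S : U -> Prop) :
  noetherian_module W -> submod S ->
  (forall u, S u -> killed fs u -> u = 0) -> fin_gen_sub S.
Proof.
move=> noethW; elim: fs S => [|f fs ih] S S_ S0.
  by exists [::]; split=> // x /S0; apply.
pose T w := exists2 u, S u & w = f u.
have T_ : submod T.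
  split=> [|a _ _ [x Sx ->] [y Sy ->]].
    by exists 0; rewrite ?linear0; case: S_.
  by exists (a *: x + y); rewrite ?linearP //; apply: S_.2.
have [t [tT tP]] := noethW T T_.
have [||s [sS sP]] := span_relation (T := fun w u => w = f u) _ _ tT.
- by rewrite linear0.
- by move=> a _ _ u u' -> ->; rewrite linearP.
have [||s' [s'S s'P]] := ih (fun u => S u /\ f u = 0).
- split; first by rewrite linear0; case: S_.
  move=> a x y [Sx fx] [Sy fy]; rewrite linearP fx fy scaler0 addr0.
  by split=> //; apply: S_.2.
- by move=> u [Su fu] ku; apply: S0.
exists (s ++ s'); split=> [v|x Sx].
  by rewrite mem_cat => /orP[/sS | /s'S[]].
have [|y sy fxy] := sP (f x); first by apply: tP; exists x.
rewrite -[x](subrK y) addrC; apply: submodD; first exact: span_submod.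
  by apply: span_mono sy => v; rewrite mem_cat => ->.
apply: (@span_mono _ s') => [v|]; first by rewrite mem_cat orbC => ->.
apply: s'P; rewrite linearB fxy subrr; split=> //.
by apply: submodB => //; apply: span_sub sy.
Qed.

Lemma noetherian_surj V W (p : {linear V -> W}) :
  surjective p -> noetherian_module V -> noetherian_module W.
Proof.
move=> p_surj nV S S_; pose T x := S (p x).
have T_ : submod T.
  by split=> [|a x y]; rewrite /T ?linear0 ?linearP; [case: S_ | apply: S_.2].
have [t [tT tP]] := nV T T_.
exists [seq p v | v <- t]; split=> [_ /mapP[v vt ->]|y Sy]; first exact: tT.
have [x xy] := p_surj y; rewrite -xy; apply/span_map/tP.
by rewrite /T xy.
Qed.

Lemma noetherian_fin_gen V : noetherian_module V -> fin_gen V.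
Proof. by move=> nV; apply/fin_gen_span/nV; split. Qed.

Lemma noetherian_ringP : noetherian R -> noetherian_module R^o.
Proof.
move=> nR S S_; have [n [v [vS vP]]] := nR _ (submod_closedP S_).
pose s : seq R^o := [seq v i | i <- enum 'I_n].
exists s; split=> [_ /mapP[i _ ->]|x Sx]; first exact/asboolP/vS.
have [|c ->] := vP x; first exact/asboolP.
have s_ := span_submod s; elim/big_ind: _ => [|y z sy sz|i _].
- by case: s_.
- exact: (submodD s_ sy sz).
- apply: (submodZ _ s_); apply: span_mem.
  by apply: (map_f v); rewrite mem_enum.
Qed.

Lemma row_coord_linear n (i : 'I_n) : linear ((fun x => x 0 i) : 'rV[R]_n -> R^o).
Proof. by move=> a x y; rewrite !mxE. Qed.

Definition row_coord n (i : 'I_n) : {linear 'rV[R]_n -> R^o} :=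
  linear_of (row_coord_linear i).

Lemma killed_map U W (I : eqType) (F : I -> {linear U -> W}) (s : seq I) u i :
  killed [seq F i | i <- s] u -> i \in s -> F i u = 0.
Proof.
elim: s => //= j s ih [ju ku]; rewrite inE => /predU1P[-> // | ]; exact: ih.
Qed.

Lemma fin_gen_noetherian V : noetherian R -> fin_gen V -> noetherian_module V.
Proof.
move=> /noetherian_ringP nR /fin_gen_cover[n [p p_surj]].
apply: (noetherian_surj p_surj) => S S_.
apply: (fin_gen_joint_embedding (fs := [seq row_coord i | i <- enum 'I_n])) => //.
move=> u _ ku; apply/rowP => i; rewrite mxE.
by apply: (killed_map ku); rewrite mem_enum.
Qed.

Lemma fin_gen_inj U V (i : {linear U -> V}) :
  noetherian R -> injective i -> fin_gen V -> fin_gen U.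
Proof.
move=> nR i_inj /(fin_gen_noetherian nR) nV; apply/fin_gen_span.
apply: (fin_gen_joint_embedding (fs := [:: i])) => // u _ [iu _].
exact: inj_eq0 iu.
Qed.

(** A homomorphism is determined by its values on generators of the source, so
    Hom(V, W) embeds in a finite power of W. *)
Lemma fin_gen_hom V W : noetherian R -> fin_gen V -> fin_gen W -> fin_gen (Hom V W).
Proof.
move=> nR /fin_gen_span[s [_ sP]] /(fin_gen_noetherian nR) nW.
apply/fin_gen_span.
have ev_lin v : linear ((fun f => (f : {linear V -> W}) v) : Hom V W -> W) by [].
apply: (fin_gen_joint_embedding (fs := [seq linear_of (ev_lin v) | v <- s])) => //.
move=> f _ kf; apply: hom_ext => x.
apply: (span_sub (S := fun x => f x = 0) (s := s)); last exact: sP.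
  by split=> [|a y z]; rewrite ?linear0 // linearP => -> ->; rewrite scaler0 addr0.
by move=> v vs; apply: (killed_map kf).
Qed.

(** The ascending chain condition, as a maximal principle: otherwise choice
    yields a strictly increasing chain, whose union is finitely generated. *)
Lemma noetherian_max V (P : (V -> Prop) -> Prop) : noetherian_module V ->
  (exists S, submod S /\ P S) ->
  exists S, [/\ submod S, P S &
    forall T, submod T -> P T -> (forall x, S x -> T x) -> forall x, T x -> S x].
Proof.
move=> nV [S0 S0P]; apply: contrapT => noMax.
pose X := {S : V -> Prop | submod S /\ P S}.
have next (S : X) : exists T : X, (forall x, sval S x -> sval T x) /\
    exists2 x, sval T x & ~ sval S x.
  case: S => S [S_ PS] /=; apply: contrapT => noT; apply: noMax; exists S.
  split=> // T T_ PT ST x Tx; apply: contrapT => Sx; apply: noT.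
  by exists (exist _ T (conj T_ PT)); split=> //; exists x.
have [nx nxP] := choice next.
pose C n := iter n nx (exist _ S0 S0P).
have C_mono i j : (i <= j)%N -> forall x, sval (C i) x -> sval (C j) x.
  elim: j => [|j ih]; first by rewrite leqn0 => /eqP->.
  rewrite leq_eqVlt => /predU1P[-> // | ij] x xi.
  exact/(nxP (C j)).1/ih.
pose U x := exists n, sval (C n) x.
have U_ : submod U.
  split=> [|a x y [i xi] [j yj]].
    by exists 0%N; have [[]] := svalP (C 0%N).
  exists (maxn i j); have [[_ CD] _] := svalP (C (maxn i j)); apply: CD.
    by apply: C_mono xi; apply: leq_maxl.
  by apply: C_mono yj; apply: leq_maxr.
have [s [sU sP]] := nV U U_.
have [n sn] : exists n, forall v, v \in s -> sval (C n) v.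
  elim: s sU {sP} => [|v s ih] sU; first by exists 0%N.
  have [i vi] := sU v (mem_head _ _).
  have [w ws|j sj] := ih; first by apply: sU; rewrite inE ws orbT.
  exists (maxn i j) => w; rewrite inE => /predU1P[-> | ws].
    by apply: C_mono vi; apply: leq_maxl.
  by apply: (C_mono j); [apply: leq_maxr | apply: sj].
have [_ [x xn nxn]] := nxP (C n); apply: nxn.
have [Cn_ _] := svalP (C n).
by apply: span_sub (sP x _) => //; exists n.+1.
Qed.

End Span.

(** * Prime annihilators and regular elements *)

Section Regular.
Variable R : comNzRingType.
Hypothesis R_noetherian : noetherian R.

Definition ideal (I : R -> Prop) := @submod R R^o I.

Definition prime (I : R -> Prop) := forall a b, I (a * b) -> I a \/ I b.

Definition ann (V : lmodType R) (v : V) : R -> Prop := fun a => a *: v = 0.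

Definition regular (V : lmodType R) (x : R) := forall v : V, x *: v = 0 -> v = 0.

Lemma ann_ideal (V : lmodType R) (v : V) : ideal (ann v).
Proof.
split=> [|a x y]; rewrite /ann ?scale0r // => xv yv.
by rewrite scalerDl -[a *: x]/(a * x) -scalerA xv yv scaler0 addr0.
Qed.

Lemma idealMr I a b : ideal I -> I a -> I (b * a).
Proof. exact: submodZ. Qed.

(** Among the annihilators of the nonzero multiples of v, a maximal one is prime. *)
Lemma prime_ann_exists (V : lmodType R) (v : V) : v != 0 ->
  exists b, b *: v != 0 /\ prime (ann (b *: v)).
Proof.
move=> v0; have nR := noetherian_ringP R_noetherian.
pose P (I : R -> Prop) := exists b, b *: v != 0 /\ I = ann (b *: v).
have [|I [_ [b [bv ->]] Imax]] := noetherian_max (V := R^o) (P := P) nR.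
  exists (ann (1 *: v)); split; first exact: ann_ideal.
  by exists 1; rewrite scale1r.
exists b; split=> // x y xy; have [yb|yb] := eqVneq (y *: (b *: v)) 0.
  by right.
left; apply: (Imax (ann (y *: (b *: v)))); first exact: ann_ideal.
- by exists (y * b); rewrite -scalerA.
- by move=> a; rewrite /ann => ab; rewrite scalerA mulrC -scalerA ab scaler0.
- by rewrite /ann scalerA.
Qed.

(** Prime avoidance.  A prime containing another prime of the list may replace
    it; otherwise an element of I avoiding all the primes but one is corrected by
    a product lying in all the others and not in this one. *)
Lemma prime_avoidance (V : lmodType R) (I : R -> Prop) (zs : seq V) : ideal I ->
  (forall z, z \in zs -> prime (ann z) /\ exists2 a, I a & a *: z != 0) ->
  exists2 x, I x & forall z, z \in zs -> x *: z != 0.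
Proof.
move=> I_; have [n] := ubnP (size zs); elim: n zs => // n ih [|z zs] /= szs zsP.
  by exists 0; case: I_.
have [z_pr [a Ia az]] := zsP z (mem_head _ _).
have zsP' w : w \in zs -> prime (ann w) /\ exists2 a, I a & a *: w != 0.
  by move=> ws; apply: zsP; rewrite inE ws orbT.
have [[w [ws wz]] | no_w] := pselect (exists w, w \in zs /\
    forall b : R, b *: w = 0 -> b *: z = 0).
  have [||x Ix xP] := ih (z :: rem w zs).
  - by rewrite /= size_rem //; case: (zs) ws szs.
  - move=> v; rewrite inE => /predU1P[-> | /mem_rem/zsP' //]; exact: zsP (mem_head _ _).
  have xz : x *: z != 0 by apply: xP; rewrite mem_head.
  exists x => // v; rewrite inE => /predU1P[-> // | vs].
  have [-> | vw] := eqVneq v w; first by apply: contraNneq xz => /wz->.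
  apply: xP; rewrite inE; apply/orP; right.
  by move: vs; rewrite (perm_mem (perm_to_rem ws)) inE (negPf vw).
have [//|//|x Ix xP] := ih zs.
have [y [Iy yz yzs]] : exists y, [/\ I y, y *: z != 0 &
    forall w, w \in zs -> y *: w = 0].
  elim: (zs) no_w => [|w ws ihw] no_w; first by exists a.
  have [|y [Iy yz yP]] := ihw.
    by move=> [v [vs vz]]; apply: no_w; exists v; rewrite inE vs orbT.
  have [b [bw bz]] : exists b, b *: w = 0 /\ b *: z != 0.
    apply: contrapT => no_b; apply: no_w; exists w; rewrite mem_head; split=> // b bw.
    by apply: contrapT => /eqP bz; apply: no_b; exists b.
  exists (b * y); split=> [||v]; first exact: idealMr.
    apply/eqP => byz; have [/eqP|/eqP] := z_pr b y byz; exact/negP.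
  rewrite inE => /predU1P[-> | /yP yv]; last by rewrite -scalerA yv scaler0.
  by rewrite mulrC -scalerA bw scaler0.
have [xz | xz] := eqVneq (x *: z) 0; last first.
  by exists x => // v; rewrite inE => /predU1P[-> // | /xP].
exists (x + y); first exact: (@submodD R R^o).
move=> v; rewrite inE scalerDl => /predU1P[-> | vs]; first by rewrite xz add0r.
by rewrite yzs // addr0; apply: xP.
Qed.

(** Having its zero divisors in the annihilators of such a list is a property of
    submodules U that passes to U + Rz when z has prime annihilator and Rz meets U
    trivially.  A submodule maximal for it is therefore essential, so that every
    zero divisor on V is one on that submodule. *)
Lemma zero_divisor_primes (V : lmodType R) : fin_gen V -> exists zs : seq V,
  (forall z, z \in zs -> z != 0 /\ prime (ann z)) /\
  forall (x : R) (v : V), x *: v = 0 -> v != 0 -> exists2 z, z \in zs & x *: z = 0.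
Proof.
move=> /(fin_gen_noetherian R_noetherian) nV.
pose good (U : V -> Prop) := exists zs : seq V,
  (forall z, z \in zs -> z != 0 /\ prime (ann z)) /\
  forall (x : R) (v : V), U v -> x *: v = 0 -> v != 0 -> exists2 z, z \in zs & x *: z = 0.
have [|U [U_ [zs [zsP zsU]] Umax]] := noetherian_max (P := good) nV.
  exists (fun v => v = 0); split.
    by split=> [//|a x y -> ->]; rewrite scaler0 addr0.
  by exists [::]; split=> // x v ->; rewrite eqxx.
exists zs; split=> // x v xv v0.
have [[b [Ubv bv]]|noU] := pselect (exists b, U (b *: v) /\ b *: v != 0).
  by apply: zsU Ubv _ bv; rewrite scalerA mulrC -scalerA xv scaler0.
have [b [bv pr]] := prime_ann_exists v0; set z := b *: v in bv pr.
pose T w := exists u c, U u /\ w = u + c *: z.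
have T_ : submod T.
  split=> [|a _ _ [u [c [Uu ->]]] [u' [c' [Uu' ->]]]].
    by exists 0, 0; rewrite scale0r addr0; split=> //; case: U_.
  exists (a *: u + u'), (a * c + c'); split; first exact: U_.2.
  by rewrite scalerDr scalerDl scalerA addrACA.
have trivUz u c : U u -> u + c *: z = 0 -> c *: z = 0.
  move=> Uu ucz; apply: contrapT => /eqP cz; apply: noU; exists (c * b).
  rewrite -scalerA -/z; split=> //.
  have -> : c *: z = - u by apply/eqP; rewrite -addr_eq0 addrC ucz.
  exact: submodN.
have Tz : T z by exists 0, 1; rewrite scale1r add0r; split=> //; case: U_.
case: noU; exists b; rewrite -/z; split=> //; apply: Umax Tz => //; last first.
  by move=> u Uu; exists u, 0; rewrite scale0r addr0.
exists (z :: zs); split=> [w|y _ [u [c [Uu ->]]]].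
  by rewrite inE => /predU1P[-> // | /zsP].
rewrite scalerDr scalerA => yuc uc.
have ycz : (y * c) *: z = 0 by apply: trivUz yuc; apply: submodZ.
have [yz|cz] := pr y c ycz; first by exists z; rewrite ?mem_head.
have cz0 : c *: z = 0 by [].
move: yuc uc; rewrite ycz cz0 !addr0 => yu u0.
by have [w ws yw] := zsU y u Uu yu u0; exists w; rewrite // inE ws orbT.
Qed.

(** An ideal of zero divisors lies in one of finitely many prime annihilators. *)
Lemma regular_exists (V : lmodType R) (I : R -> Prop) : ideal I -> fin_gen V ->
  (forall v : V, (forall a, I a -> a *: v = 0) -> v = 0) ->
  exists2 x, I x & regular V x.
Proof.
move=> I_ fV soc; have [zs [zsP zsV]] := zero_divisor_primes fV.
have [|x Ix xP] := @prime_avoidance V I zs I_.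
  move=> z /zsP[z0 z_pr]; split=> //; apply: contrapT => noa.
  move/eqP: z0; apply; apply: soc => a Ia; apply: contrapT => /eqP az.
  by apply: noa; exists a.
exists x => // v xv; apply: contrapT => /eqP v0.
by have [z /xP/eqP] := zsV x v xv v0.
Qed.

End Regular.

(** * Nakayama's lemma *)

Section Local.
Variables (R : comNzRingType) (m : idealr R).
Hypotheses (R_noetherian : noetherian R) (R_local : local_ring m).

Lemma max_ideal : ideal (fun a => a \in m).
Proof. by have [m0 mD] := idealr_submod m; split=> // a x y; apply: mD. Qed.

(** A proper ideal maximal among those containing a is a maximal ideal, hence is m. *)
Lemma unit_notin_max a : a \notin m -> exists u, u * a = 1.
Proof.
move=> am; apply: contrapT => no_u.
have nR := noetherian_ringP R_noetherian.
have [|I [I_ [I1 Ia] Imax]] :=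
    noetherian_max (V := R^o) (P := fun I => ~ I 1 /\ I a) nR.
  exists (fun x => exists u, x = u * a); split.
    split=> [|c _ _ [u ->] [v ->]]; first by exists 0; rewrite mul0r.
    by exists (c * u + v); rewrite mulrDl -mulrA.
  split=> [[u u1]|]; first by apply: no_u; exists u.
  by exists 1; rewrite mul1r.
pose J : {pred R} := fun x => `[< I x >].
have Jm : J =i m.
  apply: R_local.2; split=> [|K [K0 K1 KD] JK x].
    have [J0 JD] := submod_closedP I_.
    by split=> //; apply/asboolP.
  apply/idP/asboolP => [Kx|Ix]; last by apply: JK; apply/asboolP.
  apply: (Imax (fun x => x \in K)) => //.
  - split; first exact/negP.
    by apply: (JK a); apply/asboolP.
  - by move=> y Iy; apply: (JK y); apply/asboolP.
by case/negP: am; rewrite -Jm; apply/asboolP.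
Qed.

Lemma one_sub_unit a : a \in m -> exists u, u * (1 - a) = 1.
Proof.
move=> am; apply: unit_notin_max; apply/negP => am1.
have [[_ /negP m1 _] _] := R_local.1; apply: m1.
by rewrite -[1](subrK a); apply: (@submodD R R^o _ _ _ max_ideal).
Qed.

(** Eliminate the generators one at a time: an equation v = a v + (others) with
    a in m is solved for v since 1 - a is invertible. *)
Lemma nakayama_gens (V : lmodType R) (B : V -> Prop) (zs : seq V) : submod B ->
  (forall z, z \in zs -> exists2 y, span_in (fun a => a \in m) zs y & B (z - y)) ->
  forall z, z \in zs -> B z.
Proof.
move=> B_; have [m0 mD] := max_ideal.
have m_ (s : seq V) : submod (span_in (fun a => a \in m) s).
  exact: span_in_submod.
elim: zs => // v s ih vsP.
have [_ [a [y [am sy ->]]] Bv] := vsP v (mem_head _ _).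
have [u u1] := one_sub_unit am.
have Bvu : B (v - u *: y).
  have := submodZ u B_ Bv; rewrite opprD addrA -[X in X - _ - _]scale1r -scalerBl.
  by rewrite scalerBr scalerA u1 scale1r.
have sB z : z \in s -> B z.
  apply: ih => {}z zs.
  have [|_ [b [w [bm sw ->]]] Bz] := vsP z; first by rewrite inE zs orbT.
  exists (b *: (u *: y) + w); first by apply: (m_ s).2 => //; apply: submodZ.
  have -> : z - (b *: (u *: y) + w) = (z - (b *: v + w)) + b *: (v - u *: y).
    by rewrite scalerBr !opprD !addrA [_ - w + _]addrAC subrK [RHS]addrAC.
  by apply: submodD => //; apply: submodZ.
move=> z; rewrite inE => /predU1P[-> | /sB //].
rewrite -[v](subrK (u *: y)); apply: submodD => //; apply: submodZ => //.
by apply: span_in_sub sy => // c w _ /sB; apply: submodZ.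
Qed.

Definition fin_gen_mod (V : lmodType R) (Z B : V -> Prop) :=
  exists zs : seq V, (forall z, z \in zs -> Z z) /\
    forall z, Z z -> exists2 y, span zs y & B (z - y).

(** Nakayama's lemma for the quotient Z/B; that Z = mZ + B is expressed by the
    submodules T containing both mZ and B. *)
Lemma nakayama (V : lmodType R) (Z B : V -> Prop) : submod B -> fin_gen_mod Z B ->
  (forall T : V -> Prop, submod T -> (forall z, B z -> T z) ->
    (forall a z, a \in m -> Z z -> T (a *: z)) -> forall z, Z z -> T z) ->
  forall z, Z z -> B z.
Proof.
move=> B_ [zs [zsZ zsP]] ZT; have [m0 mD] := max_ideal.
have m_ := span_in_submod zs m0 mD.
have zsB : forall z, z \in zs -> B z.
  apply: (nakayama_gens B_) => z zzs.
  apply: (ZT (fun z => exists2 y, span_in (fun a => a \in m) zs y & B (z - y))).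
  - split=> [|a x x' [y sy By] [y' sy' By']].
      by exists 0; [case: m_ | rewrite subr0; case: B_].
    exists (a *: y + y'); first exact: m_.2.
    by rewrite opprD addrACA -scalerBr; apply: B_.2.
  - by move=> b Bb; exists 0; [case: m_ | rewrite subr0].
  - move=> a w am /zsP[y sy By]; exists (a *: y); last first.
      by rewrite -scalerBr; apply: submodZ.
    elim: (zs) y sy {By} => [_ ->|v s ih _ [b [y [_ sy ->]]]] /=.
      by rewrite scaler0.
    exists (a * b), (a *: y); rewrite scalerDr scalerA; split=> //; last exact: ih.
    by rewrite mulrC; apply: (@submodZ R R^o) max_ideal am.
  - exact: zsZ.
move=> z /zsP[y sy By]; rewrite -[z](subrK y); apply: submodD => //.
exact: span_sub sy.
Qed.

Lemma nakayama_module (V : lmodType R) : fin_gen V ->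
  (forall T : V -> Prop, submod T -> (forall a z, a \in m -> T (a *: z)) ->
    forall z, T z) ->
  forall z : V, z = 0.
Proof.
move=> /fin_gen_span[s [_ sP]] VT z.
apply: (nakayama (Z := fun=> True) (B := fun z : V => z = 0)) => //.
- by split=> // a x y -> ->; rewrite scaler0 addr0.
- by exists s; split=> // y yT; exists y; rewrite ?subrr //; apply: sP.
by move=> T T_ _ mT y _; apply: VT => // a x am; apply: mT.
Qed.

End Local.

(** * Ext in its second variable *)

Section ExtSecond.
Variable R : comNzRingType.
Implicit Types A B C M N : lmodType R.

Lemma projective_lift_image (P V B : lmodType R) (f : {linear P -> V})
    (p : {linear B -> V}) : projective P -> (forall x, exists y, f x = p y) ->
  exists g : {linear P -> B}, forall x, p (g x) = f x.
Proof.
move=> P_proj fp; have [W [q [i [q_surj i_inj pE]]]] := image_factor p.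
have [|f' f'E] := @factor_inj _ _ _ _ i f i_inj.
  by move=> x; have [y ->] := fp x; exists (q y); rewrite pE.
have [g gE] := P_proj _ _ q f' q_surj.
by exists g => x; rewrite pE gE f'E.
Qed.

Lemma res_diff_diff N n (x : res N n.+2) : res_diff (res_diff x) = 0.
Proof. by apply/res_exactS; exists x. Qed.

(** Cocycles and coboundaries are predicates on bare functions, so that linear
    combinations of cochains need not be packaged as linear maps. *)
Definition is_cocycle N M i (f : res N i -> M) :=
  forall x : res N i.+1, f (res_diff x) = 0.

Definition is_coboundary N M i : (res N i -> M) -> Prop :=
  match i return ((res N i -> M) -> Prop) with
  | 0 => fun f => forall x, f x = 0
  | j.+1 => fun f => exists g : {linear res N j -> M}, forall x, f x = g (res_diff x)
  end.

Definition Ext_vanishes N M i :=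
  forall f : {linear res N i -> M}, is_cocycle f -> is_coboundary f.

Lemma coboundary0 N M i : @is_coboundary N M i (fun=> 0).
Proof. by case: i => //= i; exists \0. Qed.

Lemma coboundary_comb N M i a (f g : res N i -> M) :
  is_coboundary f -> is_coboundary g -> is_coboundary (fun x => a *: f x + g x).
Proof.
case: i f g => [|i] f g /=; first by move=> f0 g0 x; rewrite f0 g0 scaler0 addr0.
move=> [f' fE] [g' gE]; exists ((a \*: f') \+ g') => x /=.
by rewrite fE gE.
Qed.

Lemma coboundary_sum N M i (I : Type) (s : seq I) (f : I -> res N i -> M) :
  (forall j, is_coboundary (f j)) -> is_coboundary (fun x => \sum_(j <- s) f j x).
Proof.
move=> fb; elim: s => [|j s ih].
  have := coboundary0 N M i; congr is_coboundary.
  by apply/funext => x; rewrite big_nil.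
have := coboundary_comb 1 (fb j) ih; congr is_coboundary.
by apply/funext => x; rewrite big_cons scale1r.
Qed.

Lemma coboundary_comp N M M' i (h : {linear M -> M'}) (f : res N i -> M) :
  is_coboundary f -> is_coboundary (fun x => h (f x)).
Proof.
case: i f => [|i] f /=; first by move=> f0 x; rewrite f0 linear0.
by move=> [g fE]; exists (h \o g) => x /=; rewrite fE.
Qed.

Lemma coboundary_lift N B C i (p : {linear B -> C}) (f : res N i -> C) :
  surjective p -> is_coboundary f -> exists g : {linear res N i -> B},
    [/\ is_cocycle g, is_coboundary g & forall x, p (g x) = f x].
Proof.
move=> p_surj; case: i f => [|i] f /= => [f0|[h fE]].
  by exists \0; split=> // x; rewrite f0 linear0.
have [g gE] := @projective_free_on R _ B C p h p_surj.
exists (g \o @res_diff R N i); split=> [x|/=|x /=]; rewrite ?fE //.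
  by rewrite /= res_diff_diff linear0.
by exists g.
Qed.

Definition Ext_class N M i : {linear cocycle N M i -> Ext N M i} :=
  quotm_pi (@coboundary_closed R N M i).

Lemma Ext_class_eq0 N M i (z : cocycle N M i) : Ext_class N M i z = 0 <->
  is_coboundary ((val z : Hom (res N i) M) : {linear res N i -> M}).
Proof.
rewrite -[X in _ = X](linear0 (Ext_class N M i)).
split=> [/quotm_piE|zb]; last (apply/quotm_piE; move: zb); rewrite subr0.
  case: i z => [|i] z; first by move=> /eqP-> x.
  by move=> /asboolP[g ->]; exists g.
case: i z => [|i] z; first by move=> z0; apply/eqP/val_inj/hom_ext.
by move=> [g gE]; apply/asboolP; exists g; apply: hom_ext.
Qed.

Lemma cocycle_val N M i (z : cocycle N M i) :
  is_cocycle ((val z : Hom (res N i) M) : {linear res N i -> M}).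
Proof.
move=> y; have /eqP := valP z.
exact: (congr1 (fun f : Hom _ _ => (f : {linear _ -> _}) y)).
Qed.

Lemma cocycle_exists N M i (f : {linear res N i -> M}) : is_cocycle f ->
  exists z : cocycle N M i, val z = f :> Hom (res N i) M.
Proof.
move=> fc; have fk : in_ker (@codiff R N M i) f by apply/eqP/hom_ext.
by exists (exist _ (f : Hom (res N i) M) fk).
Qed.

Lemma Ext_neq0P N M i : reflect (~ Ext_vanishes N M i) (Ext_neq0 N M i).
Proof.
apply: (iffP (asboolP _)) => [[x /eqP x0] van|van].
  apply: x0; have [z <-] := quotm_pi_surj x; apply/Ext_class_eq0/van.
  exact: cocycle_val.
apply: contrapT => no_x; apply: van => f /cocycle_exists[z <-].
apply/Ext_class_eq0; apply: contrapT => /eqP x0; apply: no_x.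
by exists (Ext_class N M i z).
Qed.

(** Multiplication by x on the resolution of N is null-homotopic when it is zero
    on N; a chain homotopy is built degree by degree. *)
Lemma Ext_kill N M i x (f : {linear res N i -> M}) :
  (forall v : N, x *: v = 0) -> is_cocycle f -> is_coboundary (fun y => x *: f y).
Proof.
move=> xN fc.
have lift j (h : {linear res N j -> res N j}) :
    (forall y, exists w, h y = @res_diff R N j w) ->
    exists s : {linear res N j -> res N j.+1}, forall y, res_diff (s y) = h y.
  by move=> hP; apply: projective_lift_image; [apply: projective_free_on | ].
have homotopy j : exists s : {linear res N j -> res N j.+1},
    forall y : res N j.+1, exists w, x *: y - s (res_diff y) = @res_diff R N j.+1 w.
  elim: j => [|j [s sP]].
    have [y|s sE] := @lift 0%N (homothety _ x).
      by apply/res_exact0; rewrite /= linearZ /= xN.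
    exists s => y; apply/res_exactS.
    by rewrite linearB linearZ /= sE /= subrr.
  have [y|t tE] := @lift j.+1 (homothety _ x \- (s \o @res_diff R N j)).
    exact: sP.
  exists t => y; apply/res_exactS.
  by rewrite linearB linearZ /= tE /= res_diff_diff linear0 subr0 subrr.
case: i f fc => [|i] f fc /=.
  move=> y; rewrite -linearZ /=.
  have [w ->] : exists w, x *: y = @res_diff R N 0 w.
    by apply/res_exact0; rewrite linearZ /= xN.
  exact: fc.
have [s sP] := homotopy i; exists (f \o s) => y /=.
have [w /(congr1 f)] := sP y.
by rewrite fc linearB linearZ => /subr0_eq.
Qed.

(** The two lifts that define the connecting map Ext^i(N, C) -> Ext^(i+1)(N, A). *)
Lemma Ext_snake N A B C (al : {linear A -> B}) (be : {linear B -> C}) i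
    (c : {linear res N i -> C}) : ses al be -> is_cocycle c ->
  exists (b : {linear res N i -> B}) (a : {linear res N i.+1 -> A}),
    [/\ forall x, be (b x) = c x, forall x, b (res_diff x) = al (a x) & is_cocycle a].
Proof.
move=> [al_inj be_surj al_be] cc.
have [b bE] := @projective_free_on R _ B C be c be_surj.
have [x|a aE] := @factor_inj R A B _ al (b \o @res_diff R N i) al_inj.
  by apply/al_be; rewrite /= bE.
exists b, a; split=> // x; apply: (inj_eq0 (f := al)) => //.
by rewrite aE /= res_diff_diff linear0.
Qed.

Section ShortExact.
Variables (N A B C : lmodType R) (al : {linear A -> B}) (be : {linear B -> C}).
Hypothesis al_be : ses al be.

Lemma Ext_vanishes_quot i :
  Ext_vanishes N B i -> Ext_vanishes N A i.+1 -> Ext_vanishes N C i.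
Proof.
move=> vB vA c cc; have [b [a [bE aE /vA[a' a'E]]]] := Ext_snake al_be cc.
have /vB/(coboundary_comp be) : is_cocycle (b \- (al \o a')).
  by move=> x /=; rewrite aE a'E subrr.
congr is_coboundary; apply/funext => x /=.
by rewrite linearB (ses_comp0 _ al_be) subr0 bE.
Qed.

(** A cochain of B lying over a coboundary of C differs from a cochain of A by a
    cocycle. *)
Lemma coboundary_sub i (b : {linear res N i -> B}) :
  is_coboundary (fun x => be (b x)) ->
  exists a : {linear res N i -> A}, forall x, b (res_diff x) = al (a (res_diff x)).
Proof.
have [al_inj be_surj al_beP] := al_be.
move=> /(coboundary_lift be_surj)[g [gc _ gE]].
have [x|a aE] := @factor_inj R A B _ al (b \- g) al_inj.
  by apply/al_beP; rewrite /= linearB gE subrr.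
by exists a => x; rewrite aE /= gc subr0.
Qed.

Lemma Ext_vanishes_sub i :
  Ext_vanishes N C i -> Ext_vanishes N B i.+1 -> Ext_vanishes N A i.+1.
Proof.
have [al_inj _ _] := al_be; move=> vC vB a ac.
have /vB[b bE] : is_cocycle (al \o a) by move=> x /=; rewrite ac linear0.
have /vC/coboundary_sub[a' a'E] : is_cocycle (be \o b).
  by move=> x; rewrite /= -bE /= (ses_comp0 _ al_be).
by exists a' => x; apply: al_inj; rewrite -a'E -bE.
Qed.

Lemma Ext_vanishes_sub0 : Ext_vanishes N B 0 -> Ext_vanishes N A 0.
Proof.
have [al_inj _ _] := al_be; move=> vB a ac x.
apply: (inj_eq0 al_inj); apply: (vB (al \o a)) => y /=.
by rewrite ac linear0.
Qed.

Definition Ext_cyclic M i := exists z0 : {linear res N i -> M}, is_cocycle z0 /\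
  forall z : {linear res N i -> M}, is_cocycle z ->
  exists r, is_coboundary (fun x => z x - r *: z0 x).

(** When Ext^(i+1)(N, A) maps to zero in Ext^(i+1)(N, B), it is the quotient of
    Ext^i(N, C) by the image of Ext^i(N, B). *)
Lemma Ext_cyclic_shift i : Ext_cyclic A i.+1 ->
  (forall a : {linear res N i.+1 -> A}, is_cocycle a ->
     is_coboundary (fun x => al (a x))) ->
  exists c0 : {linear res N i -> C}, is_cocycle c0 /\
    forall c : {linear res N i -> C}, is_cocycle c ->
    exists r (b : {linear res N i -> B}),
      is_cocycle b /\ forall x, c x = r *: c0 x + be (b x).
Proof.
have [al_inj _ _] := al_be.
move=> [a0 [a0c a0P]] ab; have [b0 b0E] := ab a0 a0c.
exists (be \o b0); split=> [x|c cc].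
  by rewrite /= -b0E (ses_comp0 _ al_be).
have [b [a [bE aE /a0P[r [a' a'E]]]]] := Ext_snake al_be cc.
exists r, (b \- (r \*: b0) \- (al \o a')); split=> [x|x] /=.
  by rewrite aE -b0E -a'E (linearB al) [al (r *: _)]linearZ subrr.
by rewrite !linearB (ses_comp0 _ al_be) subr0 bE linearZ /= subrKC.
Qed.

End ShortExact.

(** V is a direct summand of a finite power of M when its identity is a sum of
    maps through M. *)
Lemma Ext_vanishes_power N M (V : lmodType R) i (I : finType) (p : I -> {linear V -> M})
    (j : I -> {linear M -> V}) :
  (forall v, v = \sum_k j k (p k v)) -> Ext_vanishes N M i -> Ext_vanishes N V i.
Proof.
move=> vE vM f fc.
have -> : (f : res N i -> V) = (fun x => \sum_k j k (p k (f x))).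
  by apply/funext => x; rewrite -vE.
apply: coboundary_sum => k; apply: (@coboundary_comp N M V i (j k) (fun x => p k (f x))).
by apply: (vM (p k \o f)) => x /=; rewrite fc linear0.
Qed.

Lemma Ext0_vanishesP N M :
  Ext_vanishes N M 0 <-> forall f : {linear N -> M}, forall x, f x = 0.
Proof.
split=> [v f x|v f fc x].
  have [D <-] := aug_surj x; apply: (v (f \o @aug R N)) => y /=.
  have -> : aug (@res_diff R N 0 y) = 0 by apply/res_exact0; exists y.
  by rewrite linear0.
have [|g gE] := @factor_surj R _ _ M (@aug R N) f (@aug_surj R N).
  by move=> y /res_exact0[w ->]; apply: fc.
by rewrite -gE v.
Qed.

Lemma Ext_injective N (E : lmodType R) : injective_module E -> forall i,
  Ext_vanishes N E i.+1.
Proof.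
move=> E_inj i f fc.
have [W [q [j [q_surj j_inj dE]]]] := image_factor (@res_diff R N i).
have [|g gE] := @factor_surj R _ _ E q f q_surj.
  move=> x qx; have /res_exactS[w ->] : @res_diff R N i x = 0.
    by rewrite dE qx linear0.
  exact: fc.
have [h hE] := E_inj _ _ j g j_inj.
by exists h => x; rewrite dE hE gE.
Qed.

End ExtSecond.

(** * Cohomology of an injective resolution *)

Section InjectiveResolution.
Variables (R : comNzRingType) (Om : lmodType R) (E : nat -> lmodType R).
Variables (eta : {linear Om -> E 0%N}) (del : forall i, {linear E i -> E i.+1}).
Hypotheses (E_inj : forall i, injective_module (E i)) (eta_inj : injective eta).
Hypothesis eta_exact : forall x, del 0%N x = 0 <-> exists y, x = eta y.
Hypothesis del_exact : forall i x, del i.+1 x = 0 <-> exists y, x = del i y.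
Implicit Types A B C N : lmodType R.

Lemma del_del i x : del i.+1 (del i x) = 0.
Proof. by apply/del_exact; exists x. Qed.

(** H^i(N) is the cohomology of Hom(N, E), that is Ext^i(N, Om) computed with the
    injective resolution E of Om.  Its long exact sequence in N comes from
    the injectivity of the E_i; the canonical resolution of N that defines Ext is
    not exact as a functor of N. *)
Definition H_cocycle N i (f : N -> E i) := forall x, del i (f x) = 0.

Definition H_coboundary N i : (N -> E i) -> Prop :=
  match i return ((N -> E i) -> Prop) with
  | 0 => fun f => forall x, f x = 0
  | j.+1 => fun f => exists g : {linear N -> E j}, forall x, f x = del j (g x)
  end.

Definition H_vanishes N i :=
  forall f : {linear N -> E i}, H_cocycle f -> H_coboundary f.

Lemma H_coboundary0 N i : @H_coboundary N i (fun=> 0).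
Proof. by case: i => [|i] //=; exists \0 => x /=; rewrite linear0. Qed.

Lemma H_coboundary_comb N i a (f g : N -> E i) :
  H_coboundary f -> H_coboundary g -> H_coboundary (fun x => a *: f x + g x).
Proof.
case: i f g => [|i] f g /=; first by move=> f0 g0 x; rewrite f0 g0 scaler0 addr0.
move=> [f' fE] [g' gE]; exists ((a \*: f') \+ g') => x /=.
by rewrite fE gE linearP.
Qed.

Lemma H_coboundary_comp A B i (h : {linear A -> B}) (f : B -> E i) :
  H_coboundary f -> H_coboundary (fun x => f (h x)).
Proof.
case: i f => [|i] f //= [g fE].
by exists (g \o h) => x /=.
Qed.

Lemma H_coboundary_extend A B i (al : {linear A -> B}) (f : A -> E i) :
  injective al -> H_coboundary f -> exists g : {linear B -> E i},
    [/\ H_cocycle g, H_coboundary g & forall x, g (al x) = f x].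
Proof.
move=> al_inj; case: i f => [|i] f /= => [f0|[h fE]].
  by exists \0; split=> // x; rewrite ?f0 //= linear0.
have [g gE] := E_inj h al_inj.
exists (del i \o g); split=> [x||x] /=; [exact: del_del | by exists g |].
by rewrite fE gE.
Qed.

Section ShortExact.
Variables (A B C : lmodType R) (al : {linear A -> B}) (be : {linear B -> C}).
Hypothesis al_be : ses al be.

Lemma H_factor i (f : {linear B -> E i}) : (forall x, f (al x) = 0) ->
  exists g : {linear C -> E i}, forall x, g (be x) = f x.
Proof.
have [_ be_surj al_beP] := al_be; move=> f0; apply: factor_surj => // x.
by move=> /al_beP[y ->].
Qed.

Lemma H_vanishes_mid i : H_vanishes A i -> H_vanishes C i -> H_vanishes B i.
Proof.
have [al_inj be_surj _] := al_be; move=> vA vC z zc.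
have /vA/(H_coboundary_extend al_inj)[c [cc cb cE]] : H_cocycle (z \o al).
  by move=> x /=.
have [x|w wE] := @H_factor i (z \- c); first by rewrite /= cE subrr.
have /vC/(H_coboundary_comp be) : H_cocycle w.
  move=> y; have [x <-] := be_surj y.
  by rewrite wE /= linearB zc cc subrr.
move=> wb; have := H_coboundary_comb 1 wb cb; congr H_coboundary.
by apply/funext => x; rewrite scale1r wE /= subrK.
Qed.

(** The obstruction to the extension is the connecting class in H^(i+1)(C); the
    extension is exact, not up to a coboundary, since coboundaries extend. *)
Lemma H_cocycle_extend i (z : {linear A -> E i}) : H_vanishes C i.+1 -> H_cocycle z ->
  exists z' : {linear B -> E i}, H_cocycle z' /\ forall x, z' (al x) = z x.
Proof.
have [al_inj be_surj _] := al_be; move=> vC zc.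
have [g gE] := E_inj z al_inj.
have [x|w wE] := @H_factor i.+1 (del i \o g); first by rewrite /= gE zc.
have [|u uE] := vC w.
  by move=> y; have [x <-] := be_surj y; rewrite wE /= del_del.
exists (g \- (u \o be)); split=> x /=; last by rewrite (ses_comp0 _ al_be) linear0 subr0.
by rewrite linearB -uE wE /= subrr.
Qed.

Lemma H_vanishes_quot i : H_vanishes A i -> H_vanishes B i.+1 -> H_vanishes C i.+1.
Proof.
have [al_inj be_surj _] := al_be; move=> vA vB w wc.
have [|g gE] := vB (w \o be); first by move=> x /=; apply: wc.
have /vA/(H_coboundary_extend al_inj)[c [cc _ cE]] : H_cocycle (g \o al).
  by move=> x; rewrite /= -gE /= (ses_comp0 _ al_be) linear0.
have [x|h hE] := @H_factor i (g \- c); first by rewrite /= cE subrr.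
exists h => y; have [x <-] := be_surj y.
by rewrite hE /= linearB cc subr0 -gE.
Qed.

End ShortExact.

Lemma H_vanishes_beyond (n : nat) N i :
  (forall j, (n < j)%N -> forall x : E j, x = 0) -> (n < i)%N -> H_vanishes N i.
Proof.
move=> En ni f _; case: i ni f => // i ni f.
by exists \0 => x; rewrite [LHS](En i.+1) // linear0.
Qed.

Definition cocycles N i (f : Hom N (E i)) := H_cocycle (f : {linear N -> E i}).
Definition coboundaries N i (f : Hom N (E i)) := H_coboundary (f : {linear N -> E i}).

Lemma coboundaries_submod N i : submod (@coboundaries N i).
Proof. by split=> [|a f g]; [apply: H_coboundary0 | apply: H_coboundary_comb]. Qed.

Section Noetherian.
Hypotheses (R_noetherian : noetherian R) (Om_fin_gen : fin_gen Om).

(** By dimension shifting along a finitely generated free cover F of N with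
    kernel K: a cocycle N -> E_(i+1) becomes, on F, the differential of a map
    F -> E_i whose restriction to K is a cocycle, and conversely. *)
Lemma H_fin_gen N i : fin_gen N -> fin_gen_mod (@cocycles N i) (@coboundaries N i).
Proof.
elim: i N => [|i ih] N fN.
  have [s [_ sP]] := (fin_gen_span _).1 (fin_gen_hom R_noetherian fN Om_fin_gen).
  have comp_lin : linear ((fun h => eta \o (h : {linear N -> Om})) :
      Hom N Om -> Hom N (E 0%N)).
    by move=> a f g; apply: hom_ext => x /=; rewrite linearP.
  exists [seq linear_of comp_lin h | h <- s]; split=> [_ /mapP[h _ ->] x|z zc].
    by apply/eta_exact; exists ((h : {linear _ -> _}) x).
  have [x|h hE] := @factor_inj R _ _ _ eta (z : {linear _ -> _}) eta_inj.
    exact/eta_exact/zc.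
  exists (linear_of comp_lin h); first exact/span_map/sP.
  by move=> x /=; rewrite hE scaleN1r subrr.
have [n [p p_surj]] := (fin_gen_cover _).1 fN.
have [K [k kp]] := ses_of_surj p_surj; have [k_inj _ _] := kp.
have fK : fin_gen K by apply: fin_gen_inj k_inj _ => //; apply: fin_gen_row.
have [t [tZ tP]] := ih K fK.
pose T (y : Hom K (E i)) (y' : Hom N (E i.+1)) := exists g : {linear 'rV[R]_n -> E i},
  (forall x, g (k x) = (y : {linear _ -> _}) x) /\
  forall x, (y' : {linear _ -> _}) (p x) = del i (g x).
have [||y yt|s [sZ sP]] := @span_relation R _ _ T t (@cocycles N i.+1).
- by exists \0; split=> x //=; rewrite linear0.
- move=> a v v' u u' [g [gv gu]] [g' [gv' gu']].
  exists ((a \*: g) \+ g'); split=> x /=; first by rewrite gv gv'.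
  by rewrite gu gu' linearP.
- have [g gE] := E_inj (y : {linear _ -> _}) k_inj.
  have [x|w wE] := @H_factor _ _ _ _ _ kp i.+1 (del i \o g).
    by rewrite /= gE; apply: tZ.
  exists w; last by exists g.
  by move=> y'; have [x <-] := p_surj y'; rewrite wE /= del_del.
exists s; split=> // z zc.
have [x|g gE] := projective_lift_image (f := (z : {linear _ -> _}) \o p)
    (p := del i) (@projective_row R n).
  exact/del_exact/zc.
have [|y yt yb] := tP (g \o k).
  by move=> x; rewrite /= gE /= (ses_comp0 _ kp) linear0.
have [y' y's [h [hy hy']]] := sP y yt; exists y' => //.
have [u [uc _ uE]] := H_coboundary_extend k_inj yb.
have [x|v vE] := @H_factor _ _ _ _ _ kp i (g \- h \- u).
  by rewrite /= uE /= scaleN1r hy subrr.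
exists v => x; have [x' <-] := p_surj x.
by rewrite vE /= scaleN1r !linearB uc subr0 gE hy'.
Qed.

End Noetherian.

End InjectiveResolution.

(** * Depth *)

Section Depth.
Variables (R : comNzRingType) (m : idealr R).
Hypotheses (R_noetherian : noetherian R) (R_local : local_ring m).
Local Notation k := (residue_field m).

Definition residue_pi : {linear R^o -> k} := quotm_pi (idealr_submod m).

Lemma residue_pi_surj : surjective residue_pi.
Proof. exact: quotm_pi_surj. Qed.

Lemma residue_pi_eq0 a : residue_pi a = 0 <-> a \in m.
Proof.
rewrite -[X in _ = X](linear0 residue_pi); split=> [/quotm_piE|am].
  by rewrite subr0.
by apply/quotm_piE; rewrite subr0.
Qed.

Lemma residue_kill x (v : k) : x \in m -> x *: v = 0.
Proof.
move=> xm; have [a <-] := residue_pi_surj v; rewrite -linearZ; apply/residue_pi_eq0.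
by rewrite /= -[_ *: _]/(x * a) mulrC; apply: (submodZ a (max_ideal m) xm).
Qed.

Lemma scale_linear (V : lmodType R) (v : V) : linear ((fun a => a *: v) : R^o -> V).
Proof. by move=> a x y; rewrite scalerDl scalerA. Qed.

Lemma residue_map (V : lmodType R) (v : V) : (forall a, a \in m -> a *: v = 0) ->
  exists f : {linear k -> V}, forall a, f (residue_pi a) = a *: v.
Proof.
move=> mv; apply: (@factor_surj _ _ _ _ _ (linear_of (scale_linear v))).
  exact: residue_pi_surj.
by move=> a /residue_pi_eq0/mv.
Qed.

Lemma residue_map_inj (V : lmodType R) (v : V) (f : {linear k -> V}) :
  v != 0 -> (forall a, f (residue_pi a) = a *: v) -> injective f.
Proof.
move=> v0 fE; apply: linear_inj => y; have [a <-] := residue_pi_surj y.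
rewrite fE => av; apply/residue_pi_eq0; apply: contraT => am.
have [u ua] := unit_notin_max R_noetherian R_local am.
by case/eqP: v0; rewrite -[v]scale1r -ua -scalerA av scaler0.
Qed.

Definition depth_at_least (M : lmodType R) (t : nat) :=
  forall i, (i < t)%N -> Ext_vanishes k M i.

Lemma depth_geP M t : depth_ge m M t <-> depth_at_least M t.
Proof.
rewrite /depth_ge /depth; case: pselect => [ex|nex]; last first.
  split=> // _ i _; apply: contrapT => /Ext_neq0P nv.
  by apply: nex; exists i.
case: ex_minnP => n /Ext_neq0P nv nmin; split=> [tn i it|tM].
  apply: contrapT => /Ext_neq0P /nmin; apply/negP; rewrite -ltnNge.
  exact: leq_trans tn.
by rewrite leqNgt; apply/negP => /tM.
Qed.

Lemma depth_SomeP M t : depth m M = Some t ->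
  depth_at_least M t /\ ~ Ext_vanishes k M t.
Proof.
move=> tM; split; first by apply/depth_geP; rewrite /depth_ge tM.
move: tM; rewrite /depth; case: pselect => // ex [].
by case: ex_minnP => n /Ext_neq0P nv _ <-.
Qed.

Lemma depth_at_leastW M s t : (s <= t)%N -> depth_at_least M t -> depth_at_least M s.
Proof. by move=> st tM i /leq_trans/(_ st)/tM. Qed.

Lemma depth_power (M V : lmodType R) t (I : finType) (p : I -> {linear V -> M})
    (j : I -> {linear M -> V}) :
  (forall v, v = \sum_l j l (p l v)) -> depth_at_least M t -> depth_at_least V t.
Proof. by move=> vE tM i /tM; apply: Ext_vanishes_power vE. Qed.

Lemma depth_retract (M V : lmodType R) t (p : {linear V -> M}) (j : {linear M -> V}) :
  (forall v, j (p v) = v) -> depth_at_least M t -> depth_at_least V t.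
Proof.
move=> jp; apply: (@depth_power _ _ t unit (fun=> p) (fun=> j)) => v.
by rewrite (bigD1 tt) //= big1 ?addr0 // => -[].
Qed.

Section ShortExact.
Variables (A B C : lmodType R) (al : {linear A -> B}) (be : {linear B -> C}).
Hypothesis al_be : ses al be.

(** Half of the depth lemma: depth A >= min(depth B, depth C + 1). *)
Lemma depth_sub t : depth_at_least B t -> depth_at_least C t.-1 -> depth_at_least A t.
Proof.
move=> tB tC [|i] it; first exact: (Ext_vanishes_sub0 al_be (tB 0%N it)).
apply: (Ext_vanishes_sub al_be); last exact: tB.
by apply: tC; case: (t) it.
Qed.

Lemma depth_quot t : depth_at_least B t -> depth_at_least A t.+1 -> depth_at_least C t.
Proof.
by move=> tB tA i it; apply: (Ext_vanishes_quot al_be); [apply: tB | apply: tA].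
Qed.

End ShortExact.

Lemma regular_ses (M : lmodType R) x : regular M x ->
  ses (homothety M x) (coker_pi (homothety M x)).
Proof. by move=> xM; apply/ses_coker/linear_inj. Qed.

Lemma fin_gen_coker (A B : lmodType R) (f : {linear A -> B}) :
  fin_gen B -> fin_gen (coker f).
Proof. exact/fin_gen_surj/coker_pi_surj. Qed.

Lemma depth_mod_regular (M : lmodType R) x t : regular M x ->
  depth_at_least M t.+1 -> depth_at_least (coker (homothety M x)) t.
Proof.
move=> xM tM; apply: (depth_quot (regular_ses xM)) => //.
exact: depth_at_leastW tM.
Qed.

(** As x kills Ext^(i+1)(k, M), this module is a quotient of Ext^i(k, M/xM). *)
Lemma Ext_vanishes_mod_regular (M : lmodType R) x i : x \in m -> regular M x ->
  Ext_vanishes k (coker (homothety M x)) i -> Ext_vanishes k M i.+1.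
Proof.
move=> xm xM vC a ac; have sM := regular_ses xM; have [M_inj _ _] := sM.
have [b bE] := Ext_kill (fun v => residue_kill v xm) ac.
have /vC/(coboundary_sub sM)[a' a'E] : is_cocycle (coker_pi (homothety M x) \o b).
  by move=> y; rewrite /= -bE; apply: (ses_comp0 _ sM).
by exists a' => y; apply: M_inj; rewrite -a'E -bE.
Qed.

(** Positive depth means Hom(k, M) = 0, that is a zero socle. *)
Lemma depth_pos_regular (M : lmodType R) t : fin_gen M -> depth_at_least M t.+1 ->
  exists2 x, x \in m & regular M x.
Proof.
move=> fM tM; apply: regular_exists (max_ideal m) fM _ => // v mv.
have [f fE] := residue_map mv.
have /Ext0_vanishesP/(_ f (residue_pi 1)) := tM 0%N (ltn0Sn _).
by rewrite fE scale1r.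
Qed.

(** A nonzero map from the simple module k is injective. *)
Lemma residue_embedding (M : lmodType R) : ~ Ext_vanishes k M 0 ->
  exists f : {linear k -> M}, injective f.
Proof.
move=> nv; apply: contrapT => no_f; apply: nv; apply/Ext0_vanishesP => f y.
apply: contrapT => /eqP fy0; apply: no_f; exists f.
have fE a : f (residue_pi a) = a *: f (residue_pi 1).
  rewrite -linearZ; congr (f _); rewrite -linearZ /=; congr quotm_pi.
  by rewrite -[_ *: _]/(a * 1) mulr1.
apply: (residue_map_inj _ fE); apply: contraNneq fy0 => f1.
by have [a <-] := residue_pi_surj y; rewrite fE f1 scaler0.
Qed.

(** A nonzero finitely generated module maps onto k, by Nakayama. *)
Lemma no_residue_quotient (N : lmodType R) : fin_gen N ->
  (forall f : {linear N -> k}, forall x, f x = 0) -> forall x : N, x = 0.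
Proof.
move=> fN f0; have nN := fin_gen_noetherian R_noetherian fN.
apply: (nakayama_module R_noetherian R_local) => // T T_ mT z.
apply: contrapT => nTz.
pose P (S : N -> Prop) := (exists v, ~ S v) /\ forall a y, a \in m -> S (a *: y).
have [|S [S_ [[v nSv] mS] Smax]] := noetherian_max (P := P) nN.
  by exists T; split=> //; split; [exists z | move=> a y am; apply: mT].
have [U [i [i_inj iP]]] := submod_exists S_.
have piS y : coker_pi i y = 0 <-> S y.
  by rewrite coker_pi_exact iP.
have [a am|f fE] := @residue_map _ (coker_pi i v).
  by rewrite -linearZ; apply/piS/mS.
have f_inj : injective f.
  by apply: residue_map_inj fE; apply/eqP => /piS.
have f_surj y : exists a, y = f a.
  have [w <-] := coker_pi_surj y; apply: contrapT => no_a; apply: no_a.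
  pose T' w := exists a, S (w - a *: v).
  have T'w : T' w.
    apply: contrapT => nT'w; apply: nSv; apply: (Smax T'); last first.
    - by exists 1; rewrite scale1r subrr; case: S_.
    - by move=> u Su; exists 0; rewrite scale0r subr0.
    - split; first by exists w.
      by move=> b u bm; exists 0; rewrite scale0r subr0; apply: mS.
    split=> [|b u u' [a aS] [a' a'S]].
      by exists 0; rewrite scale0r subr0; case: S_.
    exists (b * a + a'); rewrite scalerDl -scalerA opprD addrACA -scalerBr.
    exact: S_.2.
  have [a aS] := T'w; exists (residue_pi a); rewrite fE -linearZ.
  by apply/subr0_eq; rewrite -linearB; apply/piS.
have [g gE] := factor_inj (f := idfun : {linear coker i -> coker i}) f_inj f_surj.
apply: nSv; apply/piS; rewrite -[LHS]gE.
have gv : g (coker_pi i v) = 0 := f0 (g \o coker_pi i) v.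
by rewrite gv linear0.
Qed.

(** If all Ext^i(N, M) up to the depth t of M vanish then so does Hom(N, M/xM)
    for an M-regular sequence x of length t; but k embeds in M/xM, and N maps
    onto k unless it is zero. *)
Lemma Ext_detects_zero t (M N : lmodType R) : fin_gen M -> fin_gen N ->
  depth_at_least M t -> ~ Ext_vanishes k M t ->
  (forall i, (i <= t)%N -> Ext_vanishes N M i) -> forall x : N, x = 0.
Proof.
move=> fM fN; elim: t M fM => [|t ih] M fM tM ntM vN.
  have [j j_inj] := residue_embedding ntM.
  apply: no_residue_quotient => // f x; apply: (inj_eq0 j_inj).
  by have /Ext0_vanishesP/(_ (j \o f)) := vN 0%N isT; apply.
have [x xm xM] := depth_pos_regular fM tM.
apply: (ih (coker (homothety M x))).
- exact: fin_gen_coker.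
- exact: depth_mod_regular.
- by move=> /(Ext_vanishes_mod_regular xm xM).
move=> i it; apply: (Ext_vanishes_quot (regular_ses xM)); apply: vN => //.
exact: leqW.
Qed.

End Depth.

(** * Vanishing of Ext into a module of finite injective dimension *)

Section FiniteInjectiveDimension.
Variables (R : comNzRingType) (m : idealr R).
Hypotheses (R_noetherian : noetherian R) (R_local : local_ring m).
Variables (Om : lmodType R) (E : nat -> lmodType R).
Variables (eta : {linear Om -> E 0%N}) (del : forall i, {linear E i -> E i.+1}).
Hypotheses (E_inj : forall i, injective_module (E i)) (eta_inj : injective eta).
Hypothesis eta_exact : forall x, del 0%N x = 0 <-> exists y, x = eta y.
Hypothesis del_exact : forall i x, del i.+1 x = 0 <-> exists y, x = del i y.
Hypothesis Om_fin_gen : fin_gen Om.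
Local Notation k := (residue_field m).
Local Notation Hv := (H_vanishes del).

Let H_nakayama N i (B : Hom N (E i) -> Prop) : fin_gen N ->
  submod B -> (forall f, coboundaries del f -> B f) ->
  (forall T : Hom N (E i) -> Prop, submod T -> (forall f, B f -> T f) ->
    (forall a f, a \in m -> cocycles del f -> T (a *: f)) ->
    forall f, cocycles del f -> T f) ->
  forall f, cocycles del f -> B f.
Proof.
move=> fN B_ cB; apply: nakayama => //.
have [s [sZ sP]] :=
  H_fin_gen E_inj eta_inj eta_exact del_exact R_noetherian Om_fin_gen i fN.
by exists s; split=> // z /sP[y sy /cB yb]; exists y.
Qed.

(** The long exact sequence of multiplication by x makes x surjective on
    H^i(N), which is finitely generated. *)
Lemma H_vanishes_regular N x i : fin_gen N -> x \in m -> regular N x ->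
  Hv (coker (homothety N x)) i.+1 -> Hv N i.
Proof.
move=> fN xm xN vC z zc.
apply: (H_nakayama (B := @coboundaries _ _ del N i)) zc => //.
  exact: coboundaries_submod.
move=> T T_ _ mT {}z zc.
have [y [yc yE]] := H_cocycle_extend E_inj del_exact (regular_ses xN) vC zc.
have -> : z = x *: (y : Hom N (E i)).
  by apply: hom_ext => v /=; rewrite -yE linearZ.
exact: mT.
Qed.

Lemma H_vanishes_residue_cyclic r (N : lmodType R) (g : N) :
  Hv k r -> (forall v, exists a, v = a *: g) -> (forall a, a \in m -> a *: g = 0) ->
  Hv N r.
Proof.
move=> vk Ng mg z zc; have [f fE] := residue_map mg.
have f_surj v : exists y, v = f y.
  by have [a ->] := Ng v; exists (residue_pi m a); rewrite fE.
have [g0|/eqP g0] := pselect (g = 0).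
  have -> : (z : N -> E r) = (fun=> 0).
    by apply/funext => v; have [a ->] := Ng v; rewrite g0 scaler0 linear0.
  exact: H_coboundary0.
have f_inj := residue_map_inj R_noetherian R_local g0 fE.
have /vk/(H_coboundary_extend E_inj del_exact f_inj)[c [_ cb cE]] :
  H_cocycle del (z \o f) by move=> y; apply: zc.
move: cb; congr H_coboundary; apply/funext => v.
by have [y ->] := f_surj v; rewrite cE.
Qed.

(** Noetherian induction on annihilators: a cyclic module N with H^r(N) nonzero
    and maximal annihilator I has I prime; if I is not m, an element of m outside
    I is regular on N, contradicting Nakayama. *)
Lemma H_vanishes_cyclic r : (forall N, fin_gen N -> Hv N r.+1) -> Hv k r ->
  forall (N : lmodType R) (g : N), (forall v, exists a, v = a *: g) -> Hv N r.
Proof.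
move=> vS vk N0 g0 N0g; apply: contrapT => nv0.
pose P (I : R^o -> Prop) := exists (N : lmodType R) (g : N),
  [/\ forall v, exists a, v = a *: g, I = ann g & ~ Hv N r].
have [|I [_ [N [g [Ng -> nvN]]] Imax]] :=
    noetherian_max (P := P) (noetherian_ringP R_noetherian).
  by exists (ann g0); split; [apply: ann_ideal | exists N0, g0].
have fin_cyc (V : lmodType R) (h : V) : (forall v, exists a, v = a *: h) -> fin_gen V.
  move=> Vh; apply/fin_gen_span; exists [:: h]; split=> // v _.
  by have [a ->] := Vh v; exists a, 0; rewrite addr0.
have I_prime a b : ann g (a * b) -> ann g a \/ ann g b.
  move=> gab; apply: contrapT => /not_orP[ga gb]; apply: nvN.
  have [U [i [i_inj iP]]] := submod_exists (submod_multiples (a *: g)).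
  have [h hE] := (iP (a *: g)).1 (ex_intro _ 1 (esym (scale1r _))).
  have iN := ses_coker i_inj.
  apply: (H_vanishes_mid E_inj del_exact iN); apply: contrapT => nv.
    apply: gb; apply: (Imax (ann h)).
    - exact: ann_ideal.
    - exists U, h; split=> // u; have [c cE] := (iP (i u)).2 (ex_intro _ u erefl).
      by exists c; apply: i_inj; rewrite cE hE linearZ.
    - move=> c gc; apply: i_inj; rewrite linearZ /= -hE linear0 scalerA mulrC -scalerA.
      by rewrite [c *: g]gc scaler0.
    - apply: i_inj; rewrite linearZ /= -hE linear0 scalerA mulrC.
      exact: gab.
  apply: ga; apply: (Imax (ann (coker_pi i g))).
  - exact: ann_ideal.
  - exists (coker i), (coker_pi i g); split=> // y.
    have [v <-] := coker_pi_surj y; have [c ->] := Ng v; exists c.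
    by rewrite linearZ.
  - by move=> c gc; rewrite /ann -linearZ [_ *: g]gc linear0.
  - by rewrite /ann -linearZ; apply/coker_pi_exact; exists h.
have [[x [xm gx]]|Im] := pselect (exists x, x \in m /\ ~ ann g x); last first.
  apply: nvN; apply: H_vanishes_residue_cyclic vk Ng _ => a am.
  by apply: contrapT => ga; apply: Im; exists a.
have xN : regular N x.
  move=> v; have [c ->] := Ng v; rewrite scalerA => /I_prime[/gx // | //].
apply/nvN/(H_vanishes_regular (fin_cyc N g Ng) xm xN)/vS.
exact/fin_gen_coker/(fin_cyc N g).
Qed.

(** A finitely generated module is filtered by cyclic ones. *)
Lemma H_vanishes_of_residue r : (forall N, fin_gen N -> Hv N r.+1) -> Hv k r ->
  forall N, fin_gen N -> Hv N r.
Proof.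
move=> vS vk N /fin_gen_span[s [_ sP]]; move: sP.
have [n] := ubnP (size s); elim: n N s => // n ih N [|v s] /= sn sP.
  move=> z _; have -> : (z : N -> E r) = (fun=> 0).
    by apply/funext => x; rewrite (sP x I) linear0.
  exact: H_coboundary0.
have [U [i [i_inj iP]]] := submod_exists (submod_multiples v).
have [h hE] := (iP v).1 (ex_intro _ 1 (esym (scale1r _))).
apply: (H_vanishes_mid E_inj del_exact (ses_coker i_inj)).
  apply: (H_vanishes_cyclic vS vk (g := h)) => u.
  have [c cE] := (iP (i u)).2 (ex_intro _ u erefl).
  by exists c; apply: i_inj; rewrite cE hE linearZ.
apply: (ih _ [seq coker_pi i w | w <- s]); first by rewrite size_map.
move=> y _; have [x <-] := coker_pi_surj y; have [a [w [_ sw ->]]] := sP x I.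
have -> : coker_pi i (a *: v + w) = coker_pi i w.
  apply/subr0_eq; rewrite -linearB addrK; apply/coker_pi_exact.
  by exists (a *: h); rewrite linearZ hE.
exact: span_map.
Qed.

Variables (d n0 : nat).
Hypothesis E_bounded : forall j, (n0 < j)%N -> forall x : E j, x = 0.
Hypotheses (R_depth : depth_at_least m R^o d) (R_depth_max : ~ Ext_vanishes k R^o d).

(** T is the quotient of R by s elements of a maximal regular sequence; H^r(T)
    vanishes for r > s since T has projective dimension s. *)
Lemma parameter_quotient s : (s <= d)%N -> exists T : lmodType R,
  [/\ fin_gen T, forall r, (s < r)%N -> Hv T r, depth_at_least m T (d - s) &
      ~ Ext_vanishes k T (d - s)].
Proof.
elim: s => [_|s ih sd].
  exists R^o; rewrite subn0; split=> //.
    exact/noetherian_fin_gen/noetherian_ringP.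
  move=> [//|r] _ z zc.
  have R_proj : projective (R^o : lmodType R).
    move=> B C p f p_surj; have [b bE] := p_surj (f 1).
    exists (linear_of (scale_linear b)) => a /=.
    by rewrite linearZ bE -linearZ /= -[_ *: _]/(a * 1) mulr1.
  have [x|g gE] := projective_lift_image (f := z) (p := del r) R_proj.
    exact/del_exact/zc.
  by exists g.
have [T [fT vT dT nT]] := ih (ltnW sd).
have ds : (d - s = (d - s.+1).+1)%N by rewrite subnS prednK // subn_gt0.
rewrite ds in dT nT.
have [x xm xT] := depth_pos_regular R_noetherian fT dT.
exists (coker (homothety T x)); split.
- exact: fin_gen_coker.
- move=> [//|r] sr; apply: (H_vanishes_quot E_inj del_exact (regular_ses xT)).
    exact: vT.
  exact/vT/ltnW.
- exact: depth_mod_regular.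
- by move=> /(Ext_vanishes_mod_regular xm xT).
Qed.

(** Descending induction on r: for the quotient T of R by a maximal regular
    sequence, H^r(T) = 0 as r > d, and k embeds in T, so H^r(k) = 0. *)
Lemma H_vanishes_above r N : (d < r)%N -> fin_gen N -> Hv N r.
Proof.
move=> dr fN; have [j] : exists j, (n0 < r + j)%N.
  by exists n0.+1; rewrite addnS ltnS leq_addl.
elim: j r N dr fN => [|j ih] r N dr fN rj.
  by rewrite addn0 in rj; apply: H_vanishes_beyond E_bounded rj.
have vS V : fin_gen V -> Hv V r.+1.
  by move=> fV; apply: ih => //; [apply: leqW | rewrite addSnnS].
apply: (H_vanishes_of_residue vS) => // z zc.
have [T [fT vT _ nT]] := parameter_quotient (leqnn d).
rewrite subnn in nT; have [f f_inj] := residue_embedding R_noetherian R_local nT.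
have [|y [yc yE]] := H_cocycle_extend E_inj del_exact (ses_coker f_inj) _ zc.
  exact/vS/fin_gen_coker.
have := H_coboundary_comp f (vT r dr y yc); congr H_coboundary.
exact/funext.
Qed.

(** Dividing by a regular element raises both the degree i and the bound
    d - depth N by one. *)
Lemma H_vanishes_depth t N i : fin_gen N -> depth_at_least m N t -> (d < i + t)%N ->
  Hv N i.
Proof.
elim: t N i => [|t ih] N i fN tN dit.
  by apply: H_vanishes_above fN; rewrite addn0 in dit.
have [x xm xN] := depth_pos_regular R_noetherian fN tN.
apply: (H_vanishes_regular fN xm xN); apply: ih; last by rewrite addSnnS.
  exact: fin_gen_coker.
exact: depth_mod_regular.
Qed.

End FiniteInjectiveDimension.

(** * Balancing Ext *)

Section Balance.
Variables (R : comNzRingType) (Om : lmodType R) (E : nat -> lmodType R).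
Variables (eta : {linear Om -> E 0%N}) (del : forall i, {linear E i -> E i.+1}).
Hypotheses (E_inj : forall i, injective_module (E i)) (eta_inj : injective eta).
Hypothesis eta_exact : forall x, del 0%N x = 0 <-> exists y, x = eta y.
Hypothesis del_exact : forall i x, del i.+1 x = 0 <-> exists y, x = del i y.
Variable N : lmodType R.
Local Notation Hv := (H_vanishes del).

Definition inj_cosyz j : lmodType R := ker (del j).

(** The proof is opaque, so that simplification does not expose the projection
    underlying the inclusion. *)
Fact inj_cosyz_embedding j :
  {i : {linear inj_cosyz j -> E j} | injective i & exact i (del j)}.
Proof.
exists (val : {linear ker (del j) -> E j}) => [x y /val_inj // | y].
split=> [ey|[x ->]]; last exact/eqP/(valP x).
have yk : in_ker (del j) y by apply/eqP.
by exists (exist _ y yk).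
Qed.

Definition inj_cosyz_in j := s2val (inj_cosyz_embedding j).

Lemma inj_cosyz_in_inj j : injective (inj_cosyz_in j).
Proof. exact: (s2valP (inj_cosyz_embedding j)). Qed.

Lemma inj_cosyz_in_exact j : exact (inj_cosyz_in j) (del j).
Proof. exact: (s2valP' (inj_cosyz_embedding j)). Qed.

Lemma inj_cosyz_ses j : exists be : {linear E j -> inj_cosyz j.+1},
  ses (inj_cosyz_in j) be /\ forall x, inj_cosyz_in j.+1 (be x) = del j x.
Proof.
have [x|be beE] := factor_inj (f := del j) (@inj_cosyz_in_inj j.+1).
  by apply/inj_cosyz_in_exact; apply: del_del.
exists be; split=> //; split=> [||y]; first exact: inj_cosyz_in_inj.
  move=> z; have /del_exact[x xE] : del j.+1 (inj_cosyz_in j.+1 z) = 0.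
    by apply/inj_cosyz_in_exact; exists z.
  by exists x; apply: inj_cosyz_in_inj; rewrite beE.
rewrite -inj_cosyz_in_exact -beE; split=> [->|/(inj_eq0 (@inj_cosyz_in_inj j.+1)) //].
by rewrite linear0.
Qed.

Lemma inj_cosyz0 : exists (p : {linear Om -> inj_cosyz 0}) (q : {linear inj_cosyz 0 -> Om}),
  (forall x, q (p x) = x) /\ (forall x, p (q x) = x).
Proof.
have [x|p pE] := factor_inj (f := eta) (@inj_cosyz_in_inj 0).
  by apply/inj_cosyz_in_exact/eta_exact; exists x.
have [x|q qE] := factor_inj (f := inj_cosyz_in 0) eta_inj.
  by apply/eta_exact/inj_cosyz_in_exact; exists x.
exists p, q; split=> x; first by apply: eta_inj; rewrite qE pE.
by apply: inj_cosyz_in_inj; rewrite pE qE.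
Qed.

Lemma cocycle0_factor (M : lmodType R) (c : {linear res N 0 -> M}) : is_cocycle c ->
  exists f : {linear N -> M}, forall x, f (aug x) = c x.
Proof.
move=> cc; apply: factor_surj => [|y /res_exact0[w ->]]; last exact: cc.
exact: (@aug_surj R N).
Qed.

Lemma aug_diff (x : res N 1) : aug (res_diff x : res N 0) = 0.
Proof. by apply/res_exact0; exists x. Qed.

(** Dimension shifting along E: Ext^(i+1)(N, Z_j) = H^(i+j+1)(N), where Z_j is the
    j-th cosyzygy of the resolution. *)
Lemma Ext_vanishes_inj_cosyz i j : Hv N (j + i.+1) -> Ext_vanishes N (inj_cosyz j) i.+1.
Proof.
elim: i j => [|i ih] j; have [be [jse beE]] := inj_cosyz_ses j; last first.
  rewrite -addSnnS => /ih vC; apply: (Ext_vanishes_sub jse) => //.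
  exact: Ext_injective.
rewrite addn1 => vN a ac; have [in_inj _ _] := jse.
have [|b bE] := @Ext_injective R N (E j) (@E_inj j) 0 (inj_cosyz_in j \o a).
  by move=> x /=; rewrite ac linear0.
have [x|c cE] := @cocycle0_factor _ (be \o b).
  by rewrite /= -bE; apply: (ses_comp0 _ jse).
have [x|g gE] := vN (inj_cosyz_in j.+1 \o c).
  by apply/inj_cosyz_in_exact; exists (c x).
have [x|a' a'E] := factor_inj (f := b \- (g \o @aug R N)) in_inj.
  have [_ _ jex] := jse; apply/jex; rewrite /= linearB /= -[be (b x)]cE.
  have -> : be (g (aug x)) = c (aug x) by apply: inj_cosyz_in_inj; rewrite beE -gE.
  exact: subrr.
exists a' => x; apply: in_inj.
by rewrite a'E /= aug_diff linear0 subr0 -bE.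
Qed.

Lemma Ext_vanishes_of_H i : Hv N i.+1 -> Ext_vanishes N Om i.+1.
Proof.
move=> /(@Ext_vanishes_inj_cosyz i 0) vN; have [p [q [qp _]]] := inj_cosyz0.
apply: (@Ext_vanishes_power R N (inj_cosyz 0) Om i.+1 unit (fun=> p) (fun=> q)) vN => x.
by rewrite (bigD1 tt) //= big1 ?addr0 // => -[].
Qed.

Definition H_cyclic i := exists z0 : {linear N -> E i}, H_cocycle del z0 /\
  forall z : {linear N -> E i}, H_cocycle del z ->
  exists r, H_coboundary del (fun x => z x - r *: z0 x).

(** The same dimension shift, carrying a generator along. *)
Lemma Ext_cyclic_inj_cosyz i j :
  Ext_cyclic N Om (j + i.+1) -> Ext_cyclic N (inj_cosyz j) i.+1.
Proof.
elim: j i => [|j ih] i.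
  rewrite add0n => -[z0 [z0c z0P]]; have [p [q [_ pq]]] := inj_cosyz0.
  exists (p \o z0); split=> [x|z zc]; first by rewrite /= z0c linear0.
  have [|r rb] := z0P (q \o z); first by move=> x /=; rewrite zc linear0.
  exists r; have := coboundary_comp p rb; congr is_coboundary.
  by apply/funext => x; rewrite linearB linearZ /= pq.
rewrite addSnnS => /ih cj; have [be [jse beE]] := inj_cosyz_ses j.
have [|c0 [c0c c0P]] := Ext_cyclic_shift jse cj.
  move=> a ac; apply: (Ext_injective (@E_inj j) (f := inj_cosyz_in j \o a)) => x /=.
  by rewrite ac linear0.
exists c0; split=> // c cc; have [r [b [bc cE]]] := c0P c cc; exists r.
have := coboundary_comp be (Ext_injective (@E_inj j) bc); congr is_coboundary.
by apply/funext => x; rewrite cE addrC addKr.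
Qed.

Lemma H_cyclic_of_Ext j : Ext_cyclic N Om j -> H_cyclic j.
Proof.
case: j => [[z0 [/cocycle0_factor[f0 f0E] z0P]]|j].
  exists (eta \o f0); split=> [x|z zc]; first by apply/eta_exact; exists (f0 x).
  have [x|f fE] := factor_inj (f := z) eta_inj; first exact/eta_exact/zc.
  have [|r rb] := z0P (f \o @aug R N); first by move=> x; rewrite /= aug_diff linear0.
  exists r => y; have [x <-] := @aug_surj R N y.
  have /= := rb x; rewrite -f0E -fE => /subr0_eq->.
  by rewrite linearZ subrr.
rewrite -addn1 => /Ext_cyclic_inj_cosyz cj; have [be [jse beE]] := inj_cosyz_ses j.
have [|c0 [c0c c0P]] := Ext_cyclic_shift jse cj.
  move=> a ac; apply: (Ext_injective (@E_inj j) (f := inj_cosyz_in j \o a)) => x /=.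
  by rewrite ac linear0.
have [f0 f0E] := cocycle0_factor c0c; rewrite addn1.
exists (inj_cosyz_in j.+1 \o f0); split=> [x|z zc].
  by apply/inj_cosyz_in_exact; exists (f0 x).
have [x|f fE] := factor_inj (f := z) (@inj_cosyz_in_inj j.+1).
  exact/inj_cosyz_in_exact/zc.
have [|r [b [bc cE]]] := c0P (f \o @aug R N).
  by move=> x /=; rewrite aug_diff linear0.
have [g gE] := cocycle0_factor bc.
exists r, g => y; have [x <-] := @aug_surj R N y.
have /= fc := cE x; rewrite -fE /= fc f0E linearD linearZ /= addrC addKr.
by rewrite beE gE.
Qed.

End Balance.

(** * Endomorphisms of the dualizing module *)

Section Dualizing.
Variables (R : comNzRingType) (m : idealr R).
Hypotheses (R_noetherian : noetherian R) (R_local : local_ring m).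
Variables (Om : lmodType R) (E : nat -> lmodType R).
Variables (eta : {linear Om -> E 0%N}) (del : forall i, {linear E i -> E i.+1}).
Hypotheses (E_inj : forall i, injective_module (E i)) (eta_inj : injective eta).
Hypothesis eta_exact : forall x, del 0%N x = 0 <-> exists y, x = eta y.
Hypothesis del_exact : forall i x, del i.+1 x = 0 <-> exists y, x = del i y.
Hypothesis Om_fin_gen : fin_gen Om.
Variables (d n0 : nat).
Hypothesis E_bounded : forall j, (n0 < j)%N -> forall x : E j, x = 0.
Hypotheses (R_depth : depth_at_least m R^o d)
  (R_depth_max : ~ Ext_vanishes (residue_field m) R^o d).
Hypotheses (Om_depth : depth_at_least m Om d)
  (Om_type : Ext_cyclic (residue_field m) Om d)
  (H_type : H_cyclic del (residue_field m) d).
Local Notation k := (residue_field m).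
Local Notation Hv := (H_vanishes del).
Local Notation dep := (depth_at_least m).

Let Hv_depth t N i : fin_gen N -> dep N t -> (d < i + t)%N -> Hv N i.
Proof.
exact: (H_vanishes_depth R_noetherian R_local E_inj eta_inj eta_exact del_exact
  Om_fin_gen E_bounded R_depth R_depth_max).
Qed.

Let extend (A B : lmodType R) (al : {linear A -> B}) (z : {linear A -> E d}) :
  fin_gen B -> injective al -> H_cocycle del z ->
  exists z' : {linear B -> E d}, H_cocycle del z' /\ forall x, z' (al x) = z x.
Proof.
move=> fB al_inj; apply: (H_cocycle_extend E_inj del_exact (ses_coker al_inj)).
by apply: (@Hv_depth 0); rewrite ?addn0 //; apply: fin_gen_coker.
Qed.

(** H^d turns injections into surjections, since H^(d+1) = 0.  So the elements of
    H^d(Y) vanishing on the socle of Y, the common kernel of generators of m,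
    lie in m H^d(Y): kill the generators one at a time. *)
Lemma H_socle (Y L : lmodType R) (ys : seq R) (i : {linear L -> Y})
    (z : Hom Y (E d)) (T : Hom Y (E d) -> Prop) :
  fin_gen Y -> injective i -> {subset ys <= m} ->
  (forall v, (exists u, v = i u) <-> (forall y, y \in ys -> y *: v = 0)) ->
  cocycles del z -> H_coboundary del (fun x => (z : {linear _ -> _}) (i x)) ->
  submod T -> (forall f, coboundaries del f -> T f) ->
  (forall a f, a \in m -> cocycles del f -> T (a *: f)) -> T z.
Proof.
move=> fY; move: ys L i z; elim=> [|y ys ih] L i z i_inj ym iP zc zi T_ bT mT.
  have [u [_ ub uE]] := H_coboundary_extend E_inj del_exact i_inj zi.
  suff <- : (u : Hom Y (E d)) = z by apply: bT.
  apply: hom_ext => v; have [w ->] : exists w, v = i w by apply/iP.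
  exact: uE.
have [L1 [i1 [i1_inj i1P]]] := submod_exists (submod_common_kernel Y ys).
have iP' u : forall y', y' \in y :: ys -> y' *: i u = 0 by apply/iP; exists u.
have [u|j jE] := @factor_inj R _ _ _ i1 i i1_inj.
  by apply/i1P => y' y'ys; apply: iP'; rewrite inE y'ys orbT.
have j_inj : injective j by move=> u v juv; apply: i_inj; rewrite -!jE juv.
have [W [q [w [q_surj w_inj qE]]]] := image_factor (homothety L1 y).
have [|c [cc cb cE]] :=
  H_coboundary_extend E_inj del_exact (f := fun x => z (i1 (j x))) j_inj.
  by move: zi; congr H_coboundary; apply/funext => x; rewrite jE.
have [v qv|z' z'E] :=
  factor_surj (f := ((z : {linear _ -> _}) \o i1) \- c) q_surj.
  have yv : y *: v = 0 by have /= := qE v; rewrite qv linear0.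
  have [u uE] : exists u, i1 v = i u.
    apply/iP => y'; rewrite inE => /predU1P[-> | ].
      by rewrite -linearZ /= yv linear0.
    move: y'; apply/i1P; by exists v.
  have -> : v = j u by apply: i1_inj; rewrite jE.
  by rewrite /= cE subrr.
have [|||z1 [z1c z1E]] := @extend W Y (i1 \o w) z' => //.
- by move=> a b /= /i1_inj/w_inj.
- move=> a; have [v <-] := q_surj a; rewrite z'E /= linearB cc.
  by rewrite zc subrr.
have ymem : y \in m by apply: ym; rewrite mem_head.
have -> : z = 1 *: (y *: (z1 : Hom Y (E d))) + (z - y *: (z1 : Hom Y (E d))).
  by rewrite scale1r addrC subrK.
apply: T_.2; first exact: mT.
apply: (ih L1 i1) => //.
- by move=> y' y'ys; apply: ym; rewrite inE y'ys orbT.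
- by move=> v; rewrite i1P.
- move=> v /=; rewrite scaleN1r linearB linearZ /= z1c scaler0 subr0; exact: zc.
move: cb; congr H_coboundary; apply/funext => v /=.
rewrite scaleN1r -linearZ -linearZ /=.
have := z'E v; rewrite -z1E /= -qE /= => ->.
by rewrite opprB addrC subrK.
Qed.

(** Nakayama: a generator of H^i(Y)/m H^i(Y) generates H^i(Y). *)
Lemma H_nakayama_cyclic (Y : lmodType R) i (z0 : {linear Y -> E i}) : fin_gen Y ->
  H_cocycle del z0 ->
  (forall T : Hom Y (E i) -> Prop, submod T -> (forall f, coboundaries del f -> T f) ->
     (forall a f, a \in m -> cocycles del f -> T (a *: f)) ->
     forall f, cocycles del f -> exists r, T (f - r *: (z0 : Hom Y (E i)))) ->
  H_cyclic del Y i.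
Proof.
move=> fY z0c zP; exists z0; split=> // z zc.
pose z0' : Hom Y (E i) := z0.
pose B (f : Hom Y (E i)) := exists r, coboundaries del (f - r *: z0').
have [c0 cD] := coboundaries_submod del Y i.
have B_ : submod B.
  split=> [|a f g [r fb] [s gb]]; first by exists 0; rewrite scale0r subr0.
  exists (a * r + s); have := cD a _ _ fb gb; congr coboundaries.
  by rewrite scalerBr scalerDl scalerA opprD addrACA.
have cB f : coboundaries del f -> B f by exists 0; rewrite scale0r subr0.
suff [r rb] : B z.
  by exists r; move: rb; congr H_coboundary; apply/funext => x /=; rewrite scaleN1r.
have [s [sZ sP]] :=
  H_fin_gen E_inj eta_inj eta_exact del_exact R_noetherian Om_fin_gen i fY.
apply: (nakayama R_noetherian R_local B_ (Z := @cocycles _ _ del Y i)) => //.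
  by exists s; split=> // f /sP[y sy /cB yb]; exists y.
move=> T T_ BT mT f fc.
have [|r rT] := zP T T_ _ mT f fc; first by move=> g /cB/BT.
rewrite -[f](subrK (r *: z0')); apply: submodD => //; apply: submodZ => //.
by apply: BT; exists 1; rewrite scale1r subrr.
Qed.

(** For t = 0 the socle of Y is k or 0, and H^d(Y)/m H^d(Y) is H^d of that socle,
    so Nakayama applies.  The induction divides by a regular element x, as
    H^i(Y)/x H^i(Y) is H^(i+1)(Y/xY). *)
Lemma H_cyclic_depth t (Y : lmodType R) i : (i + t = d)%N -> fin_gen Y -> dep Y t ->
  Ext_cyclic k Y t -> H_cyclic del Y i.
Proof.
elim: t Y i => [|t ih] Y i itd fY tY cY.
  rewrite addn0 in itd; rewrite {}itd.
  have [s [sm sP]] := noetherian_ringP R_noetherian (max_ideal m).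
  have socP (v : Y) : (forall y, y \in s -> y *: v = 0) ->
      forall a, a \in m -> a *: v = 0.
    move=> sv a /sP sa; rewrite -/(ann v a).
    by apply: (span_sub (ann_ideal v)) sa => y; apply: sv.
  have [w0 [w0c w0P]] := cY.
  have [f0 f0E] := cocycle0_factor w0c.
  pose v0 := f0 (residue_pi m 1).
  have f0v a : f0 (residue_pi m a) = a *: v0.
    rewrite -linearZ -linearZ /=; congr (f0 (quotm_pi _ _)).
    by rewrite -[_ *: _]/(a * 1) mulr1.
  have soc (v : Y) : (forall a, a \in m -> a *: v = 0) -> exists r, v = r *: v0.
    move=> mv; have [g gE] := residue_map mv.
    have [|r rb] := w0P (g \o @aug R k); first by move=> x; rewrite /= aug_diff linear0.
    have [D DE] := @aug_surj R k (residue_pi m 1); exists r.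
    have := rb D; rewrite /= DE -f0E DE gE scale1r => /subr0_eq; exact.
  have v0_soc a : a \in m -> a *: v0 = 0.
    by move=> am; rewrite -f0v; have /residue_pi_eq0 -> := am; rewrite linear0.
  have [v00|/eqP v00] := pselect (v0 = 0).
    have [L [i0 [i0_inj i0P]]] := submod_exists (submod_common_kernel Y s).
    have L0 u : i0 u = 0.
      have [|r ->] := soc (i0 u); last by rewrite v00 scaler0.
      by apply/socP/i0P; exists u.
    apply: (@H_nakayama_cyclic Y d \0) => //; first by move=> x; rewrite /= linear0.
    move=> T T_ bT mT f fc; exists 0; rewrite scale0r subr0.
    apply: (H_socle fY i0_inj (ys := s)) => // [v|].
    - by rewrite i0P.
    - have := H_coboundary0 del L d; congr H_coboundary; apply/funext => u.
      by rewrite L0 linear0.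
  have f0_inj := residue_map_inj R_noetherian R_local v00 f0v.
  have [h0 [h0c h0P]] := H_type.
  have [z0 [z0c z0E]] := extend fY f0_inj h0c.
  apply: (H_nakayama_cyclic fY z0c) => T T_ bT mT f fc.
  have [|r rb] := h0P ((f : {linear _ -> _}) \o f0); first by move=> x; apply: fc.
  exists r; apply: (H_socle fY f0_inj (ys := s)) => //.
  - move=> v; split=> [[u ->] y /sm ym|/socP/soc[a ->]].
      by rewrite -linearZ residue_kill // linear0.
    by exists (residue_pi m a).
  - by move=> x /=; rewrite scaleN1r linearB linearZ /= z0c scaler0 subr0; apply: fc.
  - move: rb; congr H_coboundary; apply/funext => x /=.
    by rewrite scaleN1r z0E.
have [x xm xY] := depth_pos_regular R_noetherian fY tY.
have sY := regular_ses xY; set Y' := coker _ in sY.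
have fY' : fin_gen Y' by apply: fin_gen_coker.
have [c0 [c0c c0P]] :=
  Ext_cyclic_shift sY cY (fun a => Ext_kill (fun v => residue_kill v xm)).
have cY' : Ext_cyclic k Y' t.
  exists c0; split=> // c cc; have [r [b [bc bE]]] := c0P c cc; exists r.
  have := coboundary_comp (coker_pi (homothety Y x)) (tY t (ltnSn t) b bc).
  by congr is_coboundary; apply/funext => y; rewrite bE addrC addKr.
have [|w0 [w0c w0P]] := ih Y' i.+1 _ fY' (depth_mod_regular xY tY) cY'.
  by rewrite addSnnS.
have vY : Hv Y i.+1 by apply: (Hv_depth fY tY); rewrite addSn itd.
have [|g0 g0E] := vY (w0 \o coker_pi (homothety Y x)); first by move=> y; apply: w0c.
apply: (@H_nakayama_cyclic Y i (x \*: g0)) => //.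
  move=> y; rewrite [LHS](_ : _ = del i (g0 (x *: y))); last first.
    by congr (del i _); rewrite linearZ.
  by rewrite -g0E /= (ses_comp0 y sY) linear0.
move=> T T_ bT mT f fc; have [Y_inj _ _] := sY.
have [g gE] := E_inj (f : {linear _ -> _}) Y_inj.
have [y|w wE] := H_factor sY (f := del i \o g); first by rewrite /= [g _]gE fc.
have [|r [u uE]] := w0P w.
  by move=> y; have [y' <-] := coker_pi_surj y; rewrite wE /= del_del.
exists r.
pose c : Hom Y (E i) := (g \- r \*: g0) \- (u \o coker_pi (homothety Y x)).
have -> : f - r *: ((x \*: g0) : Hom Y (E i)) = x *: c.
  apply: hom_ext => y /=.
  have ux : x *: u (coker_pi (homothety Y x) y) = 0.
    by rewrite -linearZ -linearZ (ses_comp0 y sY) linear0.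
  rewrite !scalerBr ux subr0 scaleN1r -gE /= linearZ; congr (_ - _).
  by rewrite !scalerA mulrC.
apply: mT => // y /=.
by rewrite !linearB linearZ /= -uE wE /= -[del i (g0 y)]g0E /= subrr.
Qed.

(** * The duality on maximal Cohen-Macaulay modules *)

Local Notation dual X := (Hom X Om).

Definition hom_pre (A B W : lmodType R) (f : {linear A -> B}) (h : Hom B W) : Hom A W :=
  (h : {linear B -> W}) \o f.

Lemma hom_pre_linear (A B W : lmodType R) (f : {linear A -> B}) :
  linear (@hom_pre A B W f).
Proof. by move=> a g h; apply: hom_ext. Qed.

HB.instance Definition _ (A B W : lmodType R) (f : {linear A -> B}) :=
  GRing.isLinear.Build R (Hom B W) (Hom A W) _ (hom_pre f) (@hom_pre_linear A B W f).

Lemma hom_left_exact (A B C W : lmodType R) (al : {linear A -> B})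
    (be : {linear B -> C}) : surjective be -> exact al be ->
  injective (hom_pre be : Hom C W -> Hom B W) /\
  exact (hom_pre be : {linear Hom C W -> Hom B W})
    (hom_pre al : {linear Hom B W -> Hom A W}).
Proof.
move=> be_surj al_be; split=> [f g fg|g].
  apply: hom_ext => y; have [x <-] := be_surj y.
  exact: (congr1 (fun h : Hom B W => (h : {linear _ -> _}) x) fg).
split=> [g0|[f ->]]; last first.
  apply: hom_ext => x /=; have -> : be (al x) = 0 by apply/al_be; exists x.
  exact: linear0.
have [x /al_be[y ->]|f fE] := factor_surj (f := (g : {linear _ -> _})) be_surj.
  exact: (congr1 (fun h : Hom A W => (h : {linear _ -> _}) y) g0).
by exists f; apply: hom_ext => x /=; rewrite fE.
Qed.

Lemma hom_ses (A B C W : lmodType R) (al : {linear A -> B}) (be : {linear B -> C}) :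
  surjective be -> exact al be ->
  (forall f : {linear A -> W}, exists g : {linear B -> W}, forall x, g (al x) = f x) ->
  ses (hom_pre be : {linear Hom C W -> Hom B W})
    (hom_pre al : {linear Hom B W -> Hom A W}).
Proof.
move=> be_surj al_be ext; have [inj ex] := hom_left_exact W be_surj al_be.
split=> // f; have [g gE] := ext f.
by exists g; apply: hom_ext.
Qed.

(** Ext^1(C, Om) = H^1(C) = 0. *)
Lemma dual_extend (A B C : lmodType R) (al : {linear A -> B}) (be : {linear B -> C}) :
  ses al be -> fin_gen C -> dep C d ->
  forall f : {linear A -> Om}, exists g : {linear B -> Om}, forall x, g (al x) = f x.
Proof.
move=> al_be fC dC f.
have [||z [zc zE]] := H_cocycle_extend E_inj del_exact al_be (i := 0) (z := eta \o f).
- by apply: (Hv_depth fC dC); rewrite add1n.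
- by move=> x; apply/eta_exact; exists (f x).
have [x|g gE] := factor_inj (f := z) eta_inj; first exact/eta_exact/zc.
by exists g => x; apply: eta_inj; rewrite gE zE.
Qed.

Lemma dual_ses (A B C : lmodType R) (al : {linear A -> B}) (be : {linear B -> C}) :
  ses al be -> fin_gen C -> dep C d ->
  ses (hom_pre be : {linear dual C -> dual B}) (hom_pre al : {linear dual B -> dual A}).
Proof.
move=> al_be fC dC; have [_ be_surj al_beP] := al_be.
by apply: hom_ses => //; apply: dual_extend al_be fC dC.
Qed.

Lemma depth_row n : dep 'rV[R]_n d.
Proof.
pose j (i : 'I_n) := linear_of (scale_linear (delta_mx 0 i : 'rV[R]_n)).
apply: (depth_power (p := @row_coord R n) (j := j)) R_depth => x.
exact: row_sum_delta.
Qed.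

Lemma hom_eval_linear (A W : lmodType R) (x : A) :
  linear ((fun f => (f : {linear A -> W}) x) : Hom A W -> W).
Proof. by []. Qed.

Definition hom_eval (A W : lmodType R) (x : A) : {linear Hom A W -> W} :=
  linear_of (@hom_eval_linear A W x).

Lemma coord_scale_linear n (i : 'I_n) (w : Om) :
  linear (fun x : 'rV[R]_n => x 0 i *: w).
Proof. by move=> a x y; rewrite !mxE scalerDl scalerA. Qed.

Lemma coord_hom_linear n (i : 'I_n) :
  linear ((fun w => linear_of (coord_scale_linear i w)) : Om -> dual 'rV[R]_n).
Proof. by move=> a w v; apply: hom_ext => x /=; rewrite scalerDr !scalerA mulrC. Qed.

Definition coord_hom n (i : 'I_n) : {linear Om -> dual 'rV[R]_n} :=
  linear_of (coord_hom_linear i).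

Lemma dual_row_sum n (f : dual 'rV[R]_n) :
  f = \sum_i coord_hom i (hom_eval Om (delta_mx 0 i) f).
Proof.
apply: hom_ext => x; rewrite -[RHS]/(hom_eval Om x _) linear_sum /=.
by rewrite [in LHS](row_sum_delta x) linear_sum; apply: eq_bigr => i _; rewrite linearZ.
Qed.

Lemma depth_dual_row n : dep (dual 'rV[R]_n) d.
Proof. exact: depth_power (@dual_row_sum n) Om_depth. Qed.

Lemma cover_ses (X : lmodType R) : fin_gen X -> dep X d.-1 ->
  exists n (K : lmodType R) (al : {linear K -> 'rV[R]_n}) (be : {linear 'rV[R]_n -> X}),
    [/\ ses al be, fin_gen K & dep K d].
Proof.
move=> /fin_gen_cover[n [be be_surj]] dX; have [K [al al_be]] := ses_of_surj be_surj.
exists n, K, al, be; split=> //.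
  by have [al_inj _ _] := al_be; apply: fin_gen_inj al_inj _ => //; apply: fin_gen_row.
by apply: (depth_sub al_be) => //; apply: depth_row.
Qed.

(** From a cover of X by a free F with kernel K comes 0 -> X* -> F* -> K* -> 0,
    where K has depth d as well: a bound on the depth of all duals improves itself
    until it reaches d. *)
Lemma depth_dual (X : lmodType R) : fin_gen X -> dep X d -> dep (dual X) d.
Proof.
suff dualt t : (t <= d)%N ->
    forall X : lmodType R, fin_gen X -> dep X d -> dep (dual X) t.
  exact: dualt.
elim: t => // t ih td {}X fX dX.
have [|n [K [al [be [al_be fK dK]]]]] := cover_ses fX.
  exact: depth_at_leastW (leq_pred d) dX.
apply: (depth_sub (dual_ses al_be fX dX)).
  exact: depth_at_leastW td (@depth_dual_row n).
exact: ih (ltnW td) K fK dK.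
Qed.

(** A presentation of X makes X* the kernel of a map F* -> G* between powers of
    Om; the depth lemma applies to the image of this map, then to its kernel. *)
Lemma depth_dual_min2 (X : lmodType R) : fin_gen X -> dep (dual X) (minn 2 d).
Proof.
move=> /fin_gen_cover[n [be be_surj]].
have [K [al al_be]] := ses_of_surj be_surj; have [al_inj _ al_beP] := al_be.
have fK : fin_gen K by apply: fin_gen_inj al_inj _ => //; apply: fin_gen_row.
have [l [q q_surj]] := (fin_gen_cover _).1 fK.
have [W [p [i [p_surj i_inj pE]]]] :=
  image_factor (hom_pre (al \o q) : {linear dual 'rV[R]_n -> dual 'rV[R]_l}).
have alq_be : exact (al \o q) be.
  move=> y; rewrite al_beP; split=> [[x ->]|[z ->]]; last by exists (q z).
  by have [z <-] := q_surj x; exists z.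
have [be_inj ex] := hom_left_exact Om be_surj alq_be.
have sW : ses (hom_pre be : {linear dual X -> dual 'rV[R]_n}) p.
  split=> // f; rewrite -ex pE; split=> [->|/(inj_eq0 i_inj) //].
  by rewrite linear0.
apply: (depth_sub sW).
  exact: depth_at_leastW (geq_minr 2 d) (@depth_dual_row n).
have dW : dep W (minn 1 d).
  apply: (depth_sub (ses_coker i_inj)).
    exact: depth_at_leastW (geq_minr 1 d) (@depth_dual_row l).
  have -> : (minn 1 d).-1 = 0%N by case: (d) => [|[]].
  by [].
apply: depth_at_leastW dW; by case: (d) => [|[|[]]].
Qed.

(** End(Om) = H^0(Om) is cyclic; a generator spans the identity and is then
    invertible by Nakayama. *)
Lemma End_homothety (f : {linear Om -> Om}) : exists r, forall w, f w = r *: w.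
Proof.
have [z0 [z0c z0P]] := H_cyclic_depth (add0n d) Om_fin_gen Om_depth Om_type.
have [w|g gE] := factor_inj (f := z0) eta_inj; first exact/eta_exact/z0c.
have gen (h : {linear Om -> Om}) : exists r, forall w, h w = r *: g w.
  have [|r rE] := z0P (eta \o h); first by move=> w; apply/eta_exact; exists (h w).
  exists r => w; apply: eta_inj; rewrite linearZ gE.
  by apply/subr0_eq/rE.
have [r rE] := gen idfun; have [s sE] := gen f.
have [rm|/(unit_notin_max R_noetherian R_local)[u ur]] := boolP (r \in m); last first.
  exists (s * u) => w; rewrite sE -scalerA; congr (_ *: _).
  by rewrite -[g w]scale1r -ur -scalerA -rE.
(* Here m Om = Om, so that Om = 0. *)
exists 0 => w; rewrite scale0r; suff -> : w = 0 by rewrite linear0.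
apply: (nakayama_module R_noetherian R_local) => // T _ mT z.
by rewrite [z]rE; apply: mT.
Qed.

Hypothesis Om_depth_max : ~ Ext_vanishes k Om d.

(** The annihilator I of Om is the kernel of R -> End(Om), a map onto a module of
    depth d, so it has depth d too; as Hom(I, Om) = 0, every Ext^i(I, Om)
    vanishes. *)
Lemma Om_faithful (r : R) : (forall w : Om, r *: w = 0) -> r = 0.
Proof.
have sc_lin (a : R) : linear (fun w : Om => a *: w).
  by move=> b x y; rewrite scalerDr !scalerA mulrC.
have h_lin : linear ((fun a => linear_of (sc_lin a)) : R^o -> dual Om).
  by move=> b x y; apply: hom_ext => w /=; rewrite scalerDl scalerA.
pose h := linear_of h_lin.
have h_surj : surjective h.
  move=> f; have [a aE] := End_homothety f; exists a.
  by apply: hom_ext => w; rewrite aE.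
have [I [i ih]] := ses_of_surj h_surj; have [i_inj _ ihP] := ih.
have hE (a : R^o) (w : Om) : (h a : {linear Om -> Om}) w = a *: w by [].
have fEnd : fin_gen (dual Om) by apply: fin_gen_hom.
have dEnd : dep (dual Om) d by apply: depth_dual.
have fI : fin_gen I.
  by apply: fin_gen_inj i_inj _ => //; apply/noetherian_fin_gen/noetherian_ringP.
have dI : dep I d.
  by apply: (depth_sub ih) => //; apply: depth_at_leastW (leq_pred d) dEnd.
have I0 : forall x : I, x = 0.
  apply: (Ext_detects_zero R_noetherian R_local Om_fin_gen fI Om_depth Om_depth_max).
  move=> [_|j _].
    apply/Ext0_vanishesP => f x; have [g gE] := dual_extend ih fEnd dEnd f.
    rewrite -gE -[i x]mulr1 -[_ * _]/(i x *: (1 : R^o)) linearZ [LHS]/= -hE.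
    by rewrite (ses_comp0 _ ih).
  apply: (Ext_vanishes_of_H E_inj eta_inj eta_exact del_exact).
  by apply: (Hv_depth fI dI); rewrite addSn ltnS leq_addl.
move=> rw; have /ihP[x ->] : h r = 0 by apply: hom_ext => w; rewrite hE rw.
by rewrite (I0 x) linear0.
Qed.

Lemma bidual_linear (X : lmodType R) :
  linear (@hom_eval X Om : X -> dual (dual X)).
Proof. by move=> a x y; apply: hom_ext => f /=; rewrite linearP. Qed.

Definition bidual (X : lmodType R) : {linear X -> dual (dual X)} :=
  linear_of (@bidual_linear X).

Lemma bidual_natural (X Y : lmodType R) (f : {linear X -> Y}) x :
  bidual Y (f x) = hom_pre (hom_pre f : {linear dual Y -> dual X}) (bidual X x).
Proof. exact: hom_ext. Qed.

Lemma bidual_row n : injective (bidual 'rV[R]_n) /\ surjective (bidual 'rV[R]_n).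
Proof.
split=> [|phi].
  apply: linear_inj => x x0; apply/rowP => i; rewrite mxE; apply: Om_faithful => w.
  exact: (congr1 (fun h : dual (dual _) => (h : {linear _ -> _}) (coord_hom i w)) x0).
have [r rE] :=
  choice (fun i => End_homothety ((phi : {linear _ -> _}) \o @coord_hom n i)).
exists (\row_i r i); apply: hom_ext => f.
rewrite [in RHS](dual_row_sum f) linear_sum -[LHS]/((f : {linear _ -> _}) (\row_i r i)).
rewrite (row_sum_delta (\row_i r i)) linear_sum; apply: eq_bigr => i _.
by rewrite linearZ mxE; have /= -> := rE i.
Qed.

Section Reflexive.
Variable X : lmodType R.
Hypotheses (X_fin_gen : fin_gen X) (X_depth : dep X d).

Let cover : exists n (K : lmodType R) (al : {linear K -> 'rV[R]_n})
  (be : {linear 'rV[R]_n -> X}), [/\ ses al be, fin_gen K & dep K d].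
Proof. exact: cover_ses (depth_at_leastW (leq_pred d) X_depth). Qed.

(** A free cover of X stays surjective after two dualizations, because the kernel
    of the cover and its dual both have depth d. *)
Lemma bidual_surj : surjective (bidual X).
Proof.
have [n [K [al [be [al_be fK dK]]]]] := cover.
have sd := dual_ses al_be X_fin_gen X_depth.
have fdK := fin_gen_hom R_noetherian fK Om_fin_gen.
move=> phi; have [psi psiE] := dual_extend sd fdK (depth_dual fK dK) phi.
have [x xE] := (bidual_row n).2 psi; exists (be x); rewrite bidual_natural xE.
by apply: hom_ext => f; apply: psiE.
Qed.

End Reflexive.

(** For a free cover F of X with kernel K, a lift to F of an element dying in X**
    has its image in F** coming from K** = K. *)
Lemma bidual_inj (X : lmodType R) : fin_gen X -> dep X d -> injective (bidual X).
Proof.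
move=> fX dX; apply: linear_inj => x x0.
have [n [K [al [be [al_be fK dK]]]]] := cover_ses fX (depth_at_leastW (leq_pred d) dX).
have [_ be_surj _] := al_be; have [y yx] := be_surj x.
have fdK := fin_gen_hom R_noetherian fK Om_fin_gen.
have [_ _ sdd] := dual_ses (dual_ses al_be fX dX) fdK (depth_dual fK dK).
have /sdd[chi chiE] : hom_pre (hom_pre be : {linear dual X -> dual 'rV[R]_n})
    (bidual _ y) = 0 by rewrite -bidual_natural yx.
have [z zE] := bidual_surj fK dK chi.
have yz : y = al z by apply: (bidual_row n).1; rewrite bidual_natural zE.
by rewrite -yx yz (ses_comp0 _ al_be).
Qed.

(** * Cosyzygies *)

Lemma mcmP (X : lmodType R) : mcm m d X <-> fin_gen X /\ dep X d.
Proof. by split=> -[fX] /depth_geP. Qed.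

(** The map i is a split monomorphism, since p extends along the preenvelope, so
    the cokernel of mu is a direct summand of X. *)
Lemma mcm_coker (C J X : lmodType R) (mu : {linear C -> X}) (p : {linear C -> J})
    (i : {linear J -> X}) : mcm_preenvelope m d mu -> mcm m d J -> surjective p ->
  (forall x, mu x = i (p x)) -> mcm m d (coker mu).
Proof.
move=> [/mcmP[fX dX] ext] mJ p_surj muE; have [h hE] := ext _ p mJ.
have hi x : h (i x) = x by have [y <-] := p_surj x; rewrite -muE -hE.
have [x /coker_pi_exact[y ->]|s sE] :=
    factor_surj (f := idfun \- (i \o h)) (coker_pi_surj (f := mu)).
  by rewrite /= muE hi subrr.
apply/mcmP; split; first exact: fin_gen_coker.
apply: (depth_retract (p := s) (j := coker_pi mu)) dX => y.
have [x <-] := coker_pi_surj y; rewrite sE /= linearB.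
have -> : coker_pi mu (i (h x)) = 0.
  by have [c <-] := p_surj (h x); rewrite -muE; apply/coker_pi_exact; exists c.
by rewrite subr0.
Qed.

(** In dimension at most one a submodule of X has depth d. *)
Lemma mcm_coker_dim1 (C X : lmodType R) (mu : {linear C -> X}) : (d <= 1)%N ->
  mcm_preenvelope m d mu -> mcm m d (coker mu).
Proof.
move=> d1 mu_pre; have [/mcmP[fX dX] _] := mu_pre.
have [J [p [i [p_surj i_inj muE]]]] := image_factor mu.
apply: (mcm_coker (p := p) (i := i)) => //; apply/mcmP; split.
  exact: fin_gen_inj i_inj _.
apply: (depth_sub (ses_coker i_inj)) => //.
by case: (d) d1 => [|[]].
Qed.

Lemma preenvelope_dual_ses (C X : lmodType R) (mu : {linear C -> X}) :
  mcm_preenvelope m d mu ->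
  ses (hom_pre (coker_pi mu) : {linear dual (coker mu) -> dual X})
      (hom_pre mu : {linear dual X -> dual C}).
Proof.
move=> [_ ext]; apply: hom_ses; [exact: coker_pi_surj | exact: coker_pi_exact |].
move=> f; have [|g gE] := ext Om f; first by apply/mcmP.
by exists g => x; rewrite gE.
Qed.

(** The bidual of D = coker mu receives D surjectively, has depth d, and every
    map from D to a reflexive module factors through it. *)
Lemma mcm_coker_coker (C X X' : lmodType R) (mu : {linear C -> X})
    (mu' : {linear coker mu -> X'}) : fin_gen C -> dep (dual C) d ->
  mcm_preenvelope m d mu -> mcm_preenvelope m d mu' -> mcm m d (coker mu').
Proof.
move=> fC dC mu_pre mu'_pre.
have [/mcmP[fX dX] _] := mu_pre; have [/mcmP[fX' dX'] _] := mu'_pre.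
have sd := preenvelope_dual_ses mu_pre.
have fdC := fin_gen_hom R_noetherian fC Om_fin_gen.
have fdD : fin_gen (dual (coker mu)).
  by apply: fin_gen_hom => //; apply: fin_gen_coker.
have dD : dep (dual (coker mu)) d.
  apply: (depth_sub sd); first exact: depth_dual.
  exact: depth_at_leastW (leq_pred d) dC.
have p_surj : surjective (bidual (coker mu)).
  move=> phi; have [psi psiE] := dual_extend sd fdC dC phi.
  have [x xE] := bidual_surj fX dX psi.
  exists (coker_pi mu x); rewrite bidual_natural xE.
  by apply: hom_ext => f; apply: psiE.
have b_inj := bidual_inj fX' dX'.
have [phi|i iE] := factor_inj
    (f := hom_pre (hom_pre mu' : {linear dual X' -> dual (coker mu)})) b_inj.
  by have [x xE] := bidual_surj fX' dX' (hom_pre (hom_pre mu') phi); exists x.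
apply: (mcm_coker mu'_pre (i := i)) p_surj _.
  by apply/mcmP; split; [apply: fin_gen_hom | apply: depth_dual].
by move=> x; apply: b_inj; rewrite iE bidual_natural.
Qed.

(** By the depth lemma on the dual sequences, each cosyzygy raises the depth of
    the dual by one. *)
Lemma cosyzygy_dual_depth (M : lmodType R) n C : fin_gen M -> cosyzygy m d M n C ->
  [/\ fin_gen C, dep (dual C) (minn n.+2 d) &
      (d <= n.+1)%N -> forall (X : lmodType R) (mu : {linear C -> X}),
        mcm_preenvelope m d mu -> mcm m d (coker mu)].
Proof.
move=> fM; elim=> {n C} [|n C X mu _ [fC dC _] mu_pre].
  by split=> // [|d1 X mu]; [apply: depth_dual_min2 | apply: mcm_coker_dim1].
have [/mcmP[fX dX] _] := mu_pre; split=> [||dn X' mu']; first exact: fin_gen_coker.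
  apply: (depth_sub (preenvelope_dual_ses mu_pre)).
    exact: depth_at_leastW (geq_minr _ _) (depth_dual fX dX).
  apply: depth_at_leastW dC; rewrite leq_min -subn1 !leq_subLR add1n geq_minl.
  exact: leq_trans (geq_minr _ _) (leq_addl _ _).
by apply: mcm_coker_coker => //; move: dC; rewrite (minn_idPr dn).
Qed.

Lemma cosyzygy_mcm (M : lmodType R) n C : fin_gen M -> (d <= n)%N ->
  cosyzygy m d M n C -> mcm m d C.
Proof.
move=> fM dn MC; case: MC dn => [d0|{n C} n C X mu MC mu_pre dn].
  by apply/mcmP; split=> // i; move: d0; rewrite leqn0 => /eqP->.
by have [_ _ mc] := cosyzygy_dual_depth fM MC; apply: mc.
Qed.

End Dualizing.

(** * The hypotheses on the ring and the dualizing module *)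

Lemma krull_dim_unique (R : comNzRingType) d d' :
  krull_dim R d -> krull_dim R d' -> d = d'.
Proof.
move=> [[p pd] maxd] [[p' pd'] maxd'].
by apply/eqP; rewrite eqn_leq (maxd' _ _ pd) (maxd _ _ pd').
Qed.

Lemma Ext_cyclic_residue (R : comNzRingType) (m : idealr R) (N M : lmodType R) i :
  isomorphic (Ext N M i) (residue_field m) -> Ext_cyclic N M i.
Proof.
move=> [f [g fK gK]].
have [z0 z0E] := quotm_pi_surj (g (residue_pi m 1)).
exists ((val z0 : Hom (res N i) M) : {linear _ -> _}).
split=> [|z /cocycle_exists[z' <-]]; first exact: cocycle_val.
have [r rE] := residue_pi_surj (f (Ext_class N M i z')); exists r.
have /Ext_class_eq0 : Ext_class N M i (z' - r *: z0) = 0.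
  apply: (can_inj fK); rewrite linear0 !linearB !linearZ /= -rE.
  have -> : f (Ext_class N M i z0) = residue_pi m 1.
    by rewrite [Ext_class _ _ _ _]z0E gK.
  have r1 : r *: residue_pi m 1 = residue_pi m r.
    by rewrite -linearZ; congr (quotm_pi _ _); apply: mulr1.
  by rewrite scalerN r1 subrr.
congr is_coboundary; apply/funext => x.
rewrite [val _](_ : _ = val z' - r *: val z0); last by rewrite linearB linearZ.
by rewrite /= scaleN1r.
Qed.

Theorem theoremC (R : comNzRingType) (m : idealr R) (d : nat)
    (Omega M : lmodType R)
    (R_noetherian : noetherian R) (R_local : local_ring m)
    (R_dim : krull_dim R d) (R_CM : cohen_macaulay m)
    (Omega_dualizing : dualizing m d Omega) (M_fin_gen : fin_gen M) :
  forall n : nat, (d <= n)%N ->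
  forall C : lmodType R, cosyzygy m d M n C -> mcm m d C.
Proof.
have [d' [R_dim' /depth_SomeP]] := R_CM.
rewrite -(krull_dim_unique R_dim R_dim') => -[R_depth R_depth_max].
have [mOm injdim iso] := Omega_dualizing.
have [n0 [E [eta [del [E_inj E_bd eta_inj eta_ex del_ex]]]]] := injdim.
have [Om_fg /depth_geP Om_depth] := mOm.
have Om_cyc := Ext_cyclic_residue iso.
have H_cyc := H_cyclic_of_Ext E_inj eta_inj eta_ex del_ex Om_cyc.
move=> n dn C; apply: (cosyzygy_mcm R_noetherian R_local E_inj eta_inj eta_ex del_ex
  Om_fg E_bd R_depth R_depth_max Om_depth Om_cyc H_cyc) => //.
move=> /Ext_neq0P; apply.
have [f [g fK gK]] := iso.
apply/asboolP; exists (g (residue_pi m 1)); apply/eqP => /(congr1 f).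
rewrite gK linear0 => /residue_pi_eq0 m1.
by have [[_ /negP[]]] := R_local.1.
Qed.
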